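(* There is an absolute constant $C>0$ such that the following holds. Let $d,k\in\mathbb{N}$, $z\ge 1$, let $X=\{x_1,\dots,x_n\}\subset\mathbb{R}^d$ be any set of points, and let $C^\ast\subset\mathbb{R}^d$, $|C^\ast|=k$, be a set of centers of an optimal $(k,z)$-clustering of $X$, i.e. $C^\ast$ minimizes $\mathrm{cost}_z(X,\cdot)$ over all $k$-point subsets of $\mathbb{R}^d$. Let $\varepsilon\in(0,1/2)$ and $$t\ \ge\ C\cdot\frac{\log k+z\log(1/\varepsilon)}{\varepsilon^2}.$$ Then with probability at least $0.9$ over the draw of $\Pi\sim\mathcal{J}_{d,t}$, $$\frac{1}{1+\varepsilon}\,\mathrm{cost}_z(X,C^\ast)\ \le\ \min_{C'\subset\mathbb{R}^t,\ |C'|=k}\mathrm{cost}_z(\Pi(X),C')\ \le\ (1+\varepsilon)\,\mathrm{cost}_z(X,C^\ast).$$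
   Context: $\mathcal{J}_{d,t}$ denotes the distribution of the linear map $\Pi:\mathbb{R}^d\to\mathbb{R}^t$, $x\mapsto Gx$, where $G$ is a $t\times d$ matrix with i.i.d. $\mathcal{N}(0,1/t)$ entries. For a finite $Y\subset\mathbb{R}^m$ and finite $C\subset\mathbb{R}^m$, $\mathrm{cost}_z(Y,C)=\big(\sum_{y\in Y}\min_{c\in C}\|y-c\|_2^z\big)^{1/z}$. *)

(* Defs.v *)
From HB Require Import structures.
From mathcomp Require Import all_boot all_order all_algebra finmap.
From mathcomp Require Import all_classical all_reals all_analysis.

Set Implicit Arguments.
Unset Strict Implicit.
Unset Printing Implicit Defensive.

Import Order.TTheory GRing.Theory Num.Theory.

Local Open Scope classical_set_scope.
Local Open Scope ring_scope.

(* The library norm on matrices is the sup norm, hence this definition. *)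
Definition l2norm (R : realType) (m : nat) (v : 'cV[R]_m) : R :=
  Num.sqrt (\sum_(i < m) v i ord0 ^+ 2).

(* For finite nonempty C (the only case used) the infimum is a minimum. *)
Definition cost (R : realType) (m : nat) (z : R) (Y C : {fset 'cV[R]_m}) : R :=
  (\sum_(y <- Y) inf [set l2norm (y - c) `^ z | c in [set` C]]) `^ z^-1.

Definition optimal_clustering (R : realType) (m k : nat) (z : R)
    (Y C : {fset 'cV[R]_m}) : Prop :=
  #|` C| = k /\
  forall C' : {fset 'cV[R]_m}, #|` C'| = k -> cost z Y C <= cost z Y C'.

Definition mutually_independent (R : realType) (d : measure_display)
    (T : measurableType d) (P : probability T R) (I : finType)
    (X : I -> {RV P >-> R}) : Prop :=
  forall (J : {set I}) (B : I -> set R),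
    (forall i, i \in J -> measurable (B i)) ->
    P (\bigcap_(i in [set` J]) (X i @^-1` B i)) =
    (\prod_(i in J) P (X i @^-1` B i))%E.

(* The second parameter of normal_prob is the standard deviation, so the
   variance is 1 / t; this is meaningful for 0 < t only (for deviation 0 the
   library's normal_prob is a uniform law). *)
Definition iid_gaussian_entries (R : realType) (d : measure_display)
    (T : measurableType d) (P : probability T R) (t n : nat)
    (G : 'I_t -> 'I_n -> {RV P >-> R}) : Prop :=
  mutually_independent (fun ij : 'I_t * 'I_n => G ij.1 ij.2) /\
  forall (i : 'I_t) (j : 'I_n) (B : set R), measurable B ->
    distribution P (G i j) B = normal_prob 0 (Num.sqrt (t%:R))^-1 B.

Definition random_map (R : realType) (d : measure_display)
    (T : measurableType d) (P : probability T R) (t n : nat)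
    (G : 'I_t -> 'I_n -> {RV P >-> R}) (w : T) (x : 'cV[R]_n) : 'cV[R]_t :=
  (\matrix_(i < t, j < n) G i j w) *m x.

(* Main.v *)
From HB Require Import structures.
Require Import Defs.
From mathcomp Require Import all_boot all_order all_algebra finmap.
From mathcomp Require Import all_classical all_reals all_analysis.
From mathcomp Require Import measurable_realfun ring lra.

(* The upper bound is the expected excess of |Pi(x - c(x))|^z over
   ((1+e)|x - c(x)|)^z, which Gaussian Laplace transforms make negligible.

   For the lower bound, call a pair contracted if Pi shrinks its distance by more
   than a factor 1+e; a given pair is contracted with probability at most
   del = exp(-t e^2/8). Weighting every point x by its optimal cost |x - c(x)|^z,
   Markov's inequality shows that few weighted pairs are contracted, so all points
   outside a light set B0 are in contracted pairs with a light set of points only.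
   Given centers c'_j in R^t, each c'_j is lifted to R^d by a Frank-Wolfe iteration:
   it maintains a convex combination q of at most O(e^-4) points outside B0, and
   adds any point x that forms no contracted pair with them and violates
   |x - q| <= (1+O(e)) |Pi x - c'_j|; the dual objective is nonpositive as long as
   the points used are not contracted, and each step raises it by a fixed amount.
   After termination the bound holds for all points but a light set, for which it
   is replaced by a detour through the optimal centers (which are lifted as well).
   No union bound over the points of X is needed, hence the dimension does not
   depend on n. *)

Set Implicit Arguments.
Unset Strict Implicit.
Unset Printing Implicit Defensive.

Import Order.TTheory GRing.Theory Num.Theory.

Local Open Scope classical_set_scope.
Local Open Scope ring_scope.

(** * Lifting one center: a Frank-Wolfe iteration *)

(** The optimal centers in the image depend on [Pi], so no probability estimate may involve them.
    Randomness enters only through [defect] and [collisions], built from pairs of points and centers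
    fixed in advance; once both are below 1 the argument is deterministic and holds for arbitrary
    [c']. The parameters are found backwards, with [e = eps / 100]. The detour of a bad point
    multiplies its weight by up to a multiple of [(16 / e) ^ z], so the bad mass must be a fraction
    of order [th1 = e ^ (3 z)]. The [k] lifts use [O(k e^-4)] points, each spoiling a mass fraction
    [th], whence [th = th1 e^5 / k]. Markov's inequality then needs [del] small against [th * th1],
    [th / k] and [1 / k^2]; [del <= e ^ (12 z) / k^2] suffices, and this is the origin of
    [log k + z log (1 / eps)] in [t]. Two obstacles lie outside the geometry: [Pi(X)] is a set, so
    points with equal images would be counted once, and the event quantifies over uncountably many
    centers, so its measurability needs a reduction to rational ones. *)

Definition dotp (R : realType) (m : nat) (u v : 'cV[R]_m) : R :=
  \sum_(i < m) u i ord0 * v i ord0.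

Definition sqn (R : realType) (m : nat) (v : 'cV[R]_m) : R := dotp v v.

Section Euclid.
Context {R : realType} {m : nat}.
Implicit Types (u v w : 'cV[R]_m) (c : R).

Lemma dotpC u v : dotp u v = dotp v u.
Proof. by apply: eq_bigr => i _; rewrite mulrC. Qed.

Lemma dotpDr u v w : dotp u (v + w) = dotp u v + dotp u w.
Proof. by rewrite -big_split; apply: eq_bigr => i _; rewrite mxE mulrDr. Qed.

Lemma dotpZr c u v : dotp u (c *: v) = c * dotp u v.
Proof. by rewrite mulr_sumr; apply: eq_bigr => i _; rewrite mxE mulrCA. Qed.

Lemma dotp0r u : dotp u 0 = 0.
Proof. by rewrite /dotp big1 // => i _; rewrite mxE mulr0. Qed.

Lemma dotp_sumr (I : finType) u (F : I -> 'cV[R]_m) :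
  dotp u (\sum_i F i) = \sum_i dotp u (F i).
Proof. exact: (big_morph (dotp u) (dotpDr u) (dotp0r u)). Qed.

Lemma sqnD u v : sqn (u + v) = sqn u + 2 * dotp u v + sqn v.
Proof.
rewrite /sqn !dotpDr dotpC dotpDr (dotpC (u + v) v) dotpDr (dotpC v u).
by ring.
Qed.

Lemma sqnZ c u : sqn (c *: u) = c ^+ 2 * sqn u.
Proof. by rewrite /sqn dotpZr dotpC dotpZr; ring. Qed.

Lemma sqnB u v : sqn (u - v) = sqn u - 2 * dotp u v + sqn v.
Proof. by rewrite sqnD -scaleN1r dotpZr sqnZ; ring. Qed.

Lemma sqnBC u v : sqn (u - v) = sqn (v - u).
Proof. by rewrite !sqnB dotpC; ring. Qed.

Lemma sqn_ge0 u : 0 <= sqn u.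
Proof. by apply: sumr_ge0 => i _; rewrite -expr2 sqr_ge0. Qed.

Lemma sqn0 : sqn (0 : 'cV[R]_m) = 0.
Proof. exact: dotp0r. Qed.

Lemma sqn_eq0 u : sqn u = 0 -> u = 0.
Proof.
move/psumr_eq0P => H; apply/matrixP => i j; rewrite ord1 mxE.
have /eqP := H (fun i _ => sqr_ge0 (u i ord0)) i isT.
by rewrite mulf_eq0 orbb => /eqP.
Qed.

Lemma l2normE u : l2norm u = Num.sqrt (sqn u).
Proof. by []. Qed.

Lemma l2norm_ge0 u : 0 <= l2norm u.
Proof. exact: sqrtr_ge0. Qed.

Lemma l2norm_sqr u : l2norm u ^+ 2 = sqn u.
Proof. by rewrite l2normE sqr_sqrtr // sqn_ge0. Qed.

Lemma l2normBC u v : l2norm (u - v) = l2norm (v - u).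
Proof. by rewrite !l2normE sqnBC. Qed.

Lemma l2norm0 : l2norm (0 : 'cV[R]_m) = 0.
Proof. by rewrite l2normE sqn0 sqrtr0. Qed.

Lemma l2norm_eq0 u : l2norm u = 0 -> u = 0.
Proof. by move=> h; apply: sqn_eq0; rewrite -l2norm_sqr h expr0n. Qed.

Lemma l2normZ c u : 0 <= c -> l2norm (c *: u) = c * l2norm u.
Proof.
by move=> c0; rewrite !l2normE sqnZ sqrtrM ?sqr_ge0 // sqrtr_sqr ger0_norm.
Qed.

Lemma dotp_le_l2norm u v : dotp u v <= l2norm u * l2norm v.
Proof.
have [v0|v0] := eqVneq (l2norm v) 0.
  by rewrite v0 (l2norm_eq0 v0) dotp0r mulr0.
have vp : 0 < l2norm v by rewrite lt_neqAle eq_sym v0 l2norm_ge0.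
have [u0|u0] := eqVneq (l2norm u) 0.
  by rewrite u0 (l2norm_eq0 u0) dotpC dotp0r mul0r.
have up : 0 < l2norm u by rewrite lt_neqAle eq_sym u0 l2norm_ge0.
have := sqn_ge0 (l2norm v *: u - l2norm u *: v).
rewrite sqnB !sqnZ dotpZr dotpC dotpZr -!l2norm_sqr (dotpC v u) => H.
have {}H : 0 <= (l2norm u * l2norm v) * (l2norm u * l2norm v - dotp u v) by nra.
by move: H; rewrite pmulr_rge0 ?mulr_gt0 // subr_ge0.
Qed.

Lemma l2norm_triangle u v : l2norm (u + v) <= l2norm u + l2norm v.
Proof.
rewrite -(@ler_pXn2r _ 2) ?nnegrE ?addr_ge0 ?l2norm_ge0 //.
rewrite l2norm_sqr sqnD -!l2norm_sqr.
by have := dotp_le_l2norm u v; nra.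
Qed.

Lemma l2norm_triangleB u v w : l2norm (u - w) <= l2norm (u - v) + l2norm (v - w).
Proof. by rewrite -[u - w](subrKA v) l2norm_triangle. Qed.

End Euclid.

Section Mean.
Context {R : realType} {m : nat} {I : finType}.
Variables (l : I -> R) (a : I -> 'cV[R]_m).
Hypothesis l1 : \sum_i l i = 1.

Definition wmean := \sum_i l i *: a i.
Definition wvar := \sum_i l i * sqn (a i) - sqn wmean.

(** Parallel axis (Huygens-Steiner) identity: the terms linear in [v] add up to a scalar product
    with the mean. *)
Lemma sum_sqn_wmean v : \sum_i l i * sqn (v - a i) = sqn (v - wmean) + wvar.
Proof.
rewrite /wvar sqnB /wmean dotp_sumr.
under eq_bigr => i _ do rewrite sqnB mulrDr mulrBr.
rewrite !big_split/= -mulr_suml l1 mul1r sumrN mulr_sumr.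
have -> : \sum_i 2 * dotp v (l i *: a i) = \sum_i l i * (2 * dotp v (a i)).
  by apply: eq_bigr => i _; rewrite dotpZr mulrCA.
by ring.
Qed.

(** Averaging the parallel axis identity over [v = a i] leaves pairwise distances only, the
    quantities that noncontraction controls. *)
Lemma wvarE : 2 * wvar = \sum_i l i * \sum_j l j * sqn (a i - a j).
Proof.
under eq_bigr do rewrite sum_sqn_wmean mulrDr sqnBC.
rewrite big_split/= sum_sqn_wmean -mulr_suml l1 subrr sqn0.
by ring.
Qed.

End Mean.

Section FrankWolfe.
Context {R : realType} {m n : nat} {I : finType}.
Variables (a : I -> 'cV[R]_m) (b : I -> 'cV[R]_n) (p : 'cV[R]_n).

Let s2 i := sqn (b i - p).
(** There is no slack factor here: the tolerance [1 + e] is put into the images, which are scaled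
    before this notion is applied. *)
Definition noncontracted i j := sqn (a i - a j) <= sqn (b i - b j).

(* Value at [l] of the dual of minimizing [max_i (sqn (a i - q) - s2 i)] over [q]. *)
Definition fw_potential (l : I -> R) := wvar l a - \sum_i l i * s2 i.

(** The mean of [s2] is at least the variance of the images, and comparing the pairwise forms of
    both variances makes that at least the variance of [a]. The same duality underlies proofs of
    Kirszbraun's extension theorem. *)
Lemma fw_potential_le0 (l : I -> R) (T : {set I}) :
  (forall i, 0 <= l i) -> \sum_i l i = 1 -> (forall i, i \notin T -> l i = 0) ->
  {in T &, forall i j, noncontracted i j} -> fw_potential l <= 0.
Proof.
move=> l0 l1 lT good; rewrite subr_le0.
have -> : \sum_i l i * s2 i = sqn (p - wmean l b) + wvar l b.
  by rewrite -sum_sqn_wmean //; apply: eq_bigr => i _; rewrite /s2 sqnBC.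
apply: (@le_trans _ _ (wvar l b)); last by rewrite lerDr sqn_ge0.
rewrite -(ler_pM2l (ltr0Sn R 1)) !wvarE //.
apply: ler_sum => i _; rewrite !mulr_sumr; apply: ler_sum => j _.
have [iT|/lT ->] := boolP (i \in T); last by rewrite !mul0r.
have [jT|/lT ->] := boolP (j \in T); last by rewrite !mul0r !mulr0.
by do 2 apply: ler_wpM2l => //; exact: good.
Qed.

Definition fw_step (al : R) (x : I) (l : I -> R) : I -> R :=
  fun i => (1 - al) * l i + al * (i == x)%:R.

Lemma sum_fw_step (V : lmodType R) al x l (f : I -> V) :
  \sum_i fw_step al x l i *: f i = (1 - al) *: (\sum_i l i *: f i) + al *: f x.
Proof.
under eq_bigr do rewrite scalerDl -!scalerA.
rewrite big_split/= -!scaler_sumr; congr (_ + _ *: _).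
rewrite (bigD1 x) //= eqxx scale1r big1 ?addr0 // => i /negPf ->.
by rewrite scale0r.
Qed.

Lemma sumr_fw_step al x l (f : I -> R) :
  \sum_i fw_step al x l i * f i = (1 - al) * (\sum_i l i * f i) + al * f x.
Proof. exact: (@sum_fw_step R^o). Qed.

(** The potential is exactly quadratic along a segment towards a vertex: the slope is the violation
    at [x] minus the current potential, the second-order loss is the squared distance to the
    mean. *)
Lemma fw_potential_step al x l :
  fw_potential (fw_step al x l) =
  fw_potential l + al * (sqn (a x - wmean l a) - s2 x - fw_potential l)
  - al ^+ 2 * sqn (a x - wmean l a).
Proof.
have mE : wmean (fw_step al x l) a = (1 - al) *: wmean l a + al *: a x.
  exact: sum_fw_step.
rewrite /fw_potential /wvar !sumr_fw_step mE.
rewrite (sqnD (_ *: _)) !sqnZ sqnB dotpZr (dotpC _ (a x)) dotpZr.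
by ring.
Qed.

Variables (e s0 : R) (U : {set I}) (y0 : I) (N : nat).
Hypothesis (e0 : 0 < e) (e1 : e <= 1) (s00 : 0 < s0) (y0U : y0 \in U).
Hypothesis s2y0 : s2 y0 = s0 ^+ 2.
Hypothesis s2U : {in U, forall x, s0 ^+ 2 <= s2 x /\ e ^+ 2 * s2 x <= s0 ^+ 2}.
Hypothesis HN : 16 < N%:R * e ^+ 4.

Let good_for (T : {set I}) x := forall y, y \in T -> noncontracted x y.

Let done_at (T : {set I}) q := forall x, x \in U -> good_for T x ->
  sqn (a x - q) <= s2 x + e * s0 ^+ 2.

(** The last clause starts from [- s0 ^+ 2], the potential of the single vertex [y0], and adds the
    guaranteed gain of each step; by [HN] its lower bound is positive at [k = N]. *)
Let state (k : nat) (T : {set I}) (l : I -> R) :=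
  [/\ T \subset U, y0 \in T, (#|T| <= k.+1)%N, {in T &, forall i j, noncontracted i j} &
   [/\ (forall i, 0 <= l i), \sum_i l i = 1, (forall i, i \notin T -> l i = 0)
    & - s0 ^+ 2 + k%:R * (e ^+ 4 * s0 ^+ 2 / 16) <= fw_potential l]].

Lemma noncontractedC i j : noncontracted i j = noncontracted j i.
Proof. by rewrite /noncontracted sqnBC (sqnBC (b i)). Qed.

Lemma noncontracted_refl i : noncontracted i i.
Proof. by rewrite /noncontracted !subrr !sqn0. Qed.

Let state0 : state 0 [set y0]%SET (fun i => (i == y0)%:R).
Proof.
have sumE (V : lmodType R) (f : I -> V) : \sum_i (i == y0)%:R *: f i = f y0.
  rewrite (bigD1 y0) //= eqxx scale1r big1 ?addr0 // => i /negPf ->.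
  by rewrite scale0r.
split; rewrite ?finset.sub1set ?finset.inE ?cards1 //.
- by move=> i j /finset.set1P -> /finset.set1P ->; exact: noncontracted_refl.
- split => //.
  + rewrite -[RHS](sumE R^o (fun=> 1)); apply: eq_bigr => i _.
    exact: (esym (mulr1 _)).
  + by move=> i; rewrite finset.inE => /negPf ->.
  + rewrite /fw_potential /wvar /wmean.
    have sumrE (f : I -> R) : \sum_i (i == y0)%:R * f i = f y0 by exact: (sumE R^o f).
    rewrite !sumrE s2y0.
    by rewrite (sumE _ a); lra.
Qed.

Let step k T l : state k T l -> done_at T (wmean l a) \/ exists T' l', state k.+1 T' l'.
Proof.
move=> [TU y0T cT gT [l0 l1 lT hl]].
have [//|] := pselect (done_at T (wmean l a)); first by left.
move=> /existsNP[x] /not_implyP[xU] /not_implyP[gx] /negP; rewrite -ltNge => vx.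
(* The gain is at least [al * eta - al ^+ 2 * W] with violation [eta = e * s0 ^+ 2] and
   [W = 4 * s0 ^+ 2 / e ^+ 2]; the step size [al = e ^+ 3 / 8] maximizes it. *)
right; exists (x |: T)%SET, (fw_step (e ^+ 3 / 8) x l).
have se i : i \in T -> e ^+ 2 * sqn (a x - a i) <= 4 * s0 ^+ 2.
  move=> iT; have := gx i iT; rewrite /noncontracted => gxi.
  have [_ hx] := s2U xU; have [_ hi] := s2U (fintype.subsetP TU _ iT).
  have : sqn (b x - b i) <= 2 * s2 x + 2 * s2 i.
    have := sqn_ge0 ((b x - p) + (b i - p)).
    have -> : b x - b i = (b x - p) - (b i - p) by rewrite opprB addrC addrA subrK addrC.
    by rewrite (sqnD (b x - p)) (sqnB (b x - p)) /s2; lra.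
  have e20 : 0 <= e ^+ 2 by rewrite sqr_ge0.
  by nra.
(* As the variance is nonnegative, the squared distance to the mean is at most the mean of the
   squared distances. *)
have W : e ^+ 2 * sqn (a x - wmean l a) <= 4 * s0 ^+ 2.
  have vp : 0 <= wvar l a.
    have := @sum_sqn_wmean R m I l a l1 (wmean l a).
    rewrite subrr sqn0 add0r => <-.
    by apply: sumr_ge0 => i _; rewrite mulr_ge0 // sqn_ge0.
  apply: (@le_trans _ _ (e ^+ 2 * \sum_i l i * sqn (a x - a i))).
    by rewrite ler_wpM2l ?sqr_ge0 // sum_sqn_wmean // lerDl.
  have -> : 4 * s0 ^+ 2 = \sum_i l i * (4 * s0 ^+ 2) by rewrite -mulr_suml l1 mul1r.
  rewrite mulr_sumr; apply: ler_sum => i _; rewrite mulrCA.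
  have [iT|/lT ->] := boolP (i \in T); last by rewrite !mul0r.
  by rewrite ler_wpM2l // se.
have e30 : 0 < e ^+ 3 by rewrite exprn_gt0.
have e31 : e ^+ 3 <= 1 by rewrite exprn_ile1 // ltW.
(* Since [h <= 0], the slope [w - s - h] is at least the violation [w - s]. *)
have h0 := fw_potential_le0 l0 l1 lT gT.
split.
- by rewrite finset.subUset finset.sub1set xU TU.
- by rewrite finset.inE y0T orbT.
- apply: leq_trans (leq_card_setU _ _) _; rewrite cards1 add1n ltnS //.
- move=> i j /finset.setU1P[->|iT] /finset.setU1P[->|jT].
  + exact: noncontracted_refl.
  + exact: gx.
  + by rewrite noncontractedC; exact: gx.
  + exact: gT.
- split.
  + by move=> i; rewrite addr_ge0 // mulr_ge0 // ?ler0n //; lra.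
  + have := sumr_fw_step (e ^+ 3 / 8) x l (fun=> 1).
    by rewrite -!mulr_suml !mulr1 l1 => ->; ring.
  + move=> i; rewrite finset.inE finset.in_set1 negb_or /fw_step => /andP[/negPf -> /lT ->].
    by rewrite !mulr0 addr0.
  + rewrite fw_potential_step; move: hl h0 vx W.
    set w := sqn (a x - _); set h := fw_potential l; set s := s2 x => hl h0 vx W.
    have vx' : e ^+ 3 / 8 * (e * s0 ^+ 2) <= e ^+ 3 / 8 * (w - s - h).
      by rewrite ler_wpM2l //; lra.
    have W' : (e ^+ 4 / 64) * (e ^+ 2 * w) <= (e ^+ 4 / 64) * (4 * s0 ^+ 2).
      by rewrite ler_wpM2l // divr_ge0 // exprn_ge0 // ltW.
    have -> : (e ^+ 3 / 8) ^+ 2 * w = (e ^+ 4 / 64) * (e ^+ 2 * w) by field.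
    have E4 : e ^+ 3 / 8 * (e * s0 ^+ 2) = e ^+ 4 * s0 ^+ 2 / 8 by field.
    have E5 : (e ^+ 4 / 64) * (4 * s0 ^+ 2) = e ^+ 4 * s0 ^+ 2 / 16 by field.
    rewrite E4 in vx'; rewrite E5 in W'.
    rewrite -natr1 mulrDl mul1r.
    set z := e ^+ 4 * s0 ^+ 2 in vx' W' hl *.
    by lra.
Qed.

Lemma frank_wolfe_near : exists (T : {set I}) q, [/\ T \subset U, y0 \in T,
  (#|T| <= N.+1)%N, {in T &, forall i j, noncontracted i j} & done_at T q].
Proof.
have H k : (exists k' T l, [/\ (k' <= k)%N, state k' T l & done_at T (wmean l a)]) \/
    exists T l, state k T l.
  elim: k => [|k [[k' [T [l [kk st dn]]]]|[T [l st]]]].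
  - by right; exists [set y0]%SET, (fun i => (i == y0)%:R).
  - by left; exists k', T, l; split => //; rewrite (leq_trans kk).
  - have [dn|[T' [l' st']]] := step st; last by right; exists T', l'.
    by left; exists k, T, l; split.
have [[k [T [l [kN [TU yT cT gT _] dn]]]]|[T [l [_ _ _ gT [l0 l1 lT hl]]]]] := H N.
  by exists T, (wmean l a); split => //; rewrite (leq_trans cT).
(* Not finished after [N] steps: the potential would be both positive and nonpositive. *)
have := le_trans hl (fw_potential_le0 l0 l1 lT gT).
have : 0 < (N%:R * e ^+ 4 - 16) * s0 ^+ 2 by rewrite mulr_gt0 ?exprn_gt0 ?subr_gt0.
by lra.
Qed.

End FrankWolfe.

Lemma frank_wolfe (R : realType) (m n : nat) (I : finType) (a : I -> 'cV[R]_m)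
    (b : I -> 'cV[R]_n) (p : 'cV[R]_n) (e : R) (U : {set I}) (N : nat) (y : I) :
  0 < e -> e <= 1 -> 16 < N%:R * e ^+ 4 -> y \in U ->
  exists (T : {set I}) q, [/\ T \subset U, (#|T| <= N.+1)%N &
    forall x, x \in U -> (forall y, y \in T -> noncontracted a b x y) ->
    l2norm (a x - q) <= (1 + 3 * e) * l2norm (b x - p)].
Proof.
move=> e0 e1 HN y_U.
have [y0 y0U ymin] : exists2 y0, y0 \in U &
    forall x, x \in U -> l2norm (b y0 - p) <= l2norm (b x - p).
  have [y0 ? ?] := @Order.TotalTheory.arg_minP _ _ _ y (mem U) (fun x => l2norm (b x - p)) y_U.
  by exists y0.
set s0 := l2norm (b y0 - p) in ymin.
have s0_ge0 : 0 <= s0 := l2norm_ge0 _.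
(* Points much farther from [p] than the nearest one are controlled by the triangle
   inequality through [y0], so the iteration only sees distances within a factor [1 / e]. *)
have [s00|s0N0] := eqVneq s0 0.
  exists (finset.set1 y0), (a y0); split; rewrite ?finset.sub1set ?cards1 //.
  move=> x xU /(_ y0); rewrite finset.in_set1 eqxx => /(_ isT).
  rewrite /noncontracted -!l2norm_sqr ler_pXn2r ?nnegrE ?l2norm_ge0 // => h.
  apply: le_trans h _; have := l2norm_triangleB (b x) p (b y0).
  rewrite (l2normBC p) -/s0 s00 addr0 => /le_trans; apply.
  by rewrite ler_peMl ?l2norm_ge0 //; lra.
have s0_gt0 : 0 < s0 by rewrite lt_neqAle eq_sym s0N0.
pose U' := finset.finset (fun x => (x \in U) && (e * l2norm (b x - p) <= s0)).
have y0U' : y0 \in U' by rewrite finset.inE y0U -/s0 ler_piMl.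
have [||T [q [TU y0T cT gT dn]]] :=
  @frank_wolfe_near R m n I a b p e s0 U' y0 N e0 e1 s0_gt0 y0U' _ _ HN.
- by rewrite -l2norm_sqr.
- move=> x; rewrite finset.inE => /andP[xU xe]; rewrite -!l2norm_sqr -exprMn.
  by rewrite !ler_pXn2r ?nnegrE ?mulr_ge0 ?l2norm_ge0 ?(ltW e0) // ymin.
exists T, q; split => //.
  by apply: fintype.subset_trans TU _; apply/fintype.subsetP => x; rewrite finset.inE => /andP[].
have near x : x \in U' -> (forall y, y \in T -> noncontracted a b x y) ->
    l2norm (a x - q) <= (1 + e) * l2norm (b x - p).
  move=> xU' gx; have xU : x \in U by move: xU'; rewrite finset.inE => /andP[].
  rewrite -(@ler_pXn2r _ 2) ?nnegrE ?mulr_ge0 ?l2norm_ge0 //; last by lra.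
  rewrite l2norm_sqr exprMn; apply: le_trans (dn x xU' gx) _.
  rewrite -l2norm_sqr; have : s0 ^+ 2 <= l2norm (b x - p) ^+ 2.
    by rewrite ler_pXn2r ?nnegrE ?l2norm_ge0 // ymin.
  have := sqr_ge0 e; have := sqr_ge0 (l2norm (b x - p)).
  by nra.
move=> x xU gx; have xs := ymin x xU.
have [xU'|] := boolP (x \in U').
  by apply: le_trans (near x xU' gx) _; rewrite ler_wpM2r ?l2norm_ge0 //; lra.
rewrite finset.inE xU /= -ltNge => far.
have y0q : l2norm (a y0 - q) <= (1 + e) * s0.
  apply: near; first exact: (fintype.subsetP TU).
  by move=> y' y'T; exact: gT.
have xy0 : l2norm (a x - a y0) <= l2norm (b x - p) + s0.
  have := gx y0 y0T; rewrite /noncontracted -!l2norm_sqr.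
  rewrite ler_pXn2r ?nnegrE ?l2norm_ge0 // => /le_trans; apply.
  by apply: le_trans (l2norm_triangleB _ p _) _; rewrite (l2normBC p).
(* The total is [|b x - p| + (2 + e) s0], and [s0 < e |b x - p|] for a far point; with [e <= 1] this
   explains the factor [1 + 3 e]. *)
apply: le_trans (l2norm_triangleB _ (a y0) _) _.
apply: le_trans (lerD xy0 y0q) _.
by nra.
Qed.

(** * Deterministic comparison of costs *)

Section PowR.
Context {R : realType}.
Implicit Types (a b e z : R).

Lemma powR_le a b z : 0 <= z -> 0 <= a -> a <= b -> a `^ z <= b `^ z.
Proof.
by move=> z0 a0 ab; rewrite ge0_ler_powR // nnegrE // (le_trans a0).
Qed.

(* One of the two summands dominates: compare [b] with [e * a]. *)
Lemma powRD_le_split a b e z : 0 < e -> 0 <= z -> 0 <= a -> 0 <= b ->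
  (a + b) `^ z <= ((1 + e) * a) `^ z + ((1 + e^-1) * b) `^ z.
Proof.
move=> e0 z0 a0 b0; have ei : 0 < e^-1 by rewrite invr_gt0.
have [ba|ab] := leP b (e * a).
  apply: (@le_trans _ _ (((1 + e) * a) `^ z)); last by rewrite lerDl powR_ge0.
  by apply: powR_le; rewrite ?addr_ge0 //; lra.
apply: (@le_trans _ _ (((1 + e^-1) * b) `^ z)); last by rewrite lerDr powR_ge0.
apply: powR_le; rewrite ?addr_ge0 //.
have : a <= e^-1 * b by rewrite -(ler_pM2l e0) mulrA divff ?gt_eqF // mul1r ltW.
by lra.
Qed.

Lemma powR_superadd a b z : 1 <= z -> 0 <= a -> 0 <= b ->
  a `^ z + b `^ z <= (a + b) `^ z.
Proof.
move=> z1 a0 b0; have z0 : 0 < z by lra.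
rewrite -!(@mulr_powRB1 _ _ z) ?addr_ge0 // mulrDl.
by apply: lerD; rewrite ler_wpM2l // powR_le ?subr_ge0 ?lerDl ?lerDr.
Qed.

Lemma powR_ge1 a z : 0 <= z -> 1 <= a -> 1 <= a `^ z.
Proof. by move=> z0 a1; apply: le_trans (powR_le z0 ler01 a1); rewrite powR1. Qed.

Lemma powR_ge_base a z : 1 <= z -> 1 <= a -> a <= a `^ z.
Proof. by move=> z1 a1; rewrite le1r_powR. Qed.

End PowR.

Section Robust.
Context {R : realType} {m n : nat} {I K J : finType}.
Variables (x : I -> 'cV[R]_m) (c : K -> 'cV[R]_m).
Variables (fx : I -> 'cV[R]_n) (fc : K -> 'cV[R]_n) (sg : I -> K).
Variables (z e th th1 : R) (N : nat).

(** Points and optimal centers share one index type, so that a single Frank-Wolfe run lifts a center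
    simultaneously with respect to both. *)
Definition pts (u : I + K) := match u with inl i => x i | inr k => c k end.
Definition imgs (u : I + K) := match u with inl i => fx i | inr k => fc k end.
Definition contracted (u v : I + K) : bool :=
  ~~ noncontracted pts (fun w => (1 + e) *: imgs w) u v.
Definition opt_dist i := l2norm (x i - c (sg i)).
Definition image_dist i := l2norm (fx i - fc (sg i)).
Definition total_cost := \sum_i opt_dist i `^ z.
Definition contracted_mass (u : I + K) := \sum_i opt_dist i `^ z * (contracted (inl i) u)%:R.
Definition excess i := Num.max 0 (image_dist i `^ z - ((1 + e) * opt_dist i) `^ z).

Hypothesis (z1 : 1 <= z) (e0 : 0 < e) (e_small : e <= 1 / 128).
Hypothesis HN : 16 < N%:R * e ^+ 4.
Hypothesis (th_gt0 : 0 < th) (th1_ge0 : 0 <= th1) (O_gt0 : 0 < total_cost).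
Hypothesis th_th1 : (#|J| * N.+1 + 1)%:R * th <= th1.
Hypothesis th1_le : th1 <= e `^ (3 * z).
Hypothesis (k0 : K).

Hypothesis contracted_centers : forall k k', ~~ contracted (inr k) (inr k').
Hypothesis contracted_points :
  \sum_i opt_dist i `^ z * contracted_mass (inl i) <= th * th1 * total_cost ^+ 2.
Hypothesis contracted_points_centers : \sum_k contracted_mass (inr k) <= th * total_cost.
Hypothesis excess_le : \sum_i excess i <= th1 * total_cost.

Variables (c' : J -> 'cV[R]_n) (tau : I -> J).

Lemma opt_dist_ge0 i : 0 <= opt_dist i. Proof. exact: l2norm_ge0. Qed.

Lemma image_dist_ge0 i : 0 <= image_dist i. Proof. exact: l2norm_ge0. Qed.

Let z0 : 0 <= z. Proof. exact: le_trans ler01 z1. Qed.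

Lemma contractedC u v : contracted u v = contracted v u.
Proof. by rewrite /contracted noncontractedC. Qed.

Lemma contracted_mass_ge0 u : 0 <= contracted_mass u.
Proof. by apply: sumr_ge0 => i _; rewrite mulr_ge0 ?powR_ge0 ?ler0n. Qed.

(** A light point must also form no contracted pair with any optimal center. The points used by the
    iteration are light, so its bound applies to every optimal center without exception. *)
Let light (u : I + K) : bool :=
  if u is inl i then (contracted_mass u <= th * total_cost) && [forall k, ~~ contracted u (inr k)]
  else true.

Let light_mass u : light u -> contracted_mass u <= th * total_cost.
Proof.
case: u => [i|k] /=; first by case/andP.
move=> _; apply: le_trans contracted_points_centers.
by rewrite (bigD1 k) //= lerDl sumr_ge0 // => k' _; exact: contracted_mass_ge0.
Qed.

(** Every cell contains all optimal centers: this makes it nonempty and gives the distances from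
    them to the lifted center that the detour needs. *)
Let cell (j : J) : {set I + K} :=
  finset.finset (fun u => light u && (if u is inl i then tau i == j else true)).

(** The first factor is the loss of [frank_wolfe], the second the scaling of the images. *)
Definition lift_factor : R := (1 + 3 * e) * (1 + e).

Let lift_center j : exists (Tq : {set I + K} * 'cV[R]_m),
  [/\ {subset Tq.1 <= light}, (#|Tq.1| <= N.+1)%N,
    forall k, l2norm (c k - Tq.2) <= lift_factor * l2norm (fc k - c' j) &
    forall i, tau i = j -> light (inl i) ->
      (forall v, v \in Tq.1 -> ~~ contracted (inl i) v) ->
      l2norm (x i - Tq.2) <= lift_factor * l2norm (fx i - c' j)].
Proof.
have [z1' [e0' es']] := conj z1 (conj e0 e_small).
have kcell k : inr k \in cell j by rewrite finset.inE.
have e1 : e <= 1 by lra.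
have [T [q [TU cT H]]] := @frank_wolfe R m n _ pts (fun w => (1 + e) *: imgs w)
  ((1 + e) *: c' j) e (cell j) N (inr k0) e0 e1 HN (kcell k0).
have Tl : {subset T <= light}.
  by move=> u /(fintype.subsetP TU); rewrite finset.inE => /andP[].
have {}H u : u \in cell j -> (forall v, v \in T -> ~~ contracted u v) ->
    l2norm (pts u - q) <= lift_factor * l2norm (imgs u - c' j).
  move=> uc ub; apply: le_trans (H u uc _) _.
    by move=> v /ub; rewrite negbK.
  by rewrite -scalerBr l2normZ ?mulrA //; lra.
exists (T, q); split => //= [k|i tij li ib].
- apply: (H (inr k)) => // -[i|k'] vT; last exact: contracted_centers.
  by have /andP[_ /forallP/(_ k)] := Tl _ vT; rewrite contractedC.
- apply: (H (inl i)) => //; rewrite finset.inE; apply/andP.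
  by split; [exact: li|exact/eqP].
Qed.

Lemma robust_lift : exists q : J -> 'cV[R]_m,
  \sum_i l2norm (x i - q (tau i)) `^ z <=
  ((1 + e) * lift_factor) `^ z * \sum_i l2norm (fx i - c' (tau i)) `^ z + e `^ z * total_cost.
Proof.
have [z1' [e0' es']] := conj z1 (conj e0 e_small).
have [Tq HTq] := boolp.choice lift_center.
exists (fun j => (Tq j).2).
pose B i := ~~ light (inl i) || [exists v in (Tq (tau i)).1, contracted (inl i) v].
have g0 : 0 <= lift_factor by rewrite /lift_factor mulr_ge0 //; lra.
have g2 : lift_factor <= 2 by rewrite /lift_factor; nra.
(* Bad mass has three sources: heavy points ([th1], by Markov), points contracted with an optimal
   center ([th]), and points contracted with one of the at most [#|J| * N.+1] used points ([th]
   each). By [th_th1] the last two together stay below [th1]. *)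
have wB : \sum_i opt_dist i `^ z * (B i)%:R <= 2 * th1 * total_cost.
  have heavy : \sum_i opt_dist i `^ z *
      (th * total_cost < contracted_mass (inl i))%R%:R <= th1 * total_cost.
    rewrite -(ler_pM2l (mulr_gt0 th_gt0 O_gt0)).
    apply: (@le_trans _ _ (th * th1 * total_cost ^+ 2)); last first.
      by rewrite le_eqVlt; apply/orP; left; apply/eqP; ring.
    apply: le_trans contracted_points; rewrite mulr_sumr; apply: ler_sum => i _.
    rewrite mulrCA ler_wpM2l ?powR_ge0 //.
    case: ltP => [/ltW|_] /=; rewrite ?mulr1 // mulr0; exact: contracted_mass_ge0.
  have badT : \sum_j \sum_(v in (Tq j).1) contracted_mass v <= (#|J| * N.+1)%:R * (th * total_cost).
    rewrite natrM -mulrA mulr_natl -sumr_const; apply: ler_sum => j _.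
    have [Tl cT _ _] := HTq j.
    apply: (@le_trans _ _ (\sum_(v in (Tq j).1) th * total_cost)).
      by apply: ler_sum => v /Tl; exact: light_mass.
    rewrite sumr_const -[leLHS]mulr_natl ler_wpM2r ?ler_nat //.
    by rewrite mulr_ge0 // ltW.
  apply: (@le_trans _ _ (\sum_i opt_dist i `^ z * (th * total_cost < contracted_mass (inl i))%R%:R +
     \sum_k contracted_mass (inr k) + \sum_j \sum_(v in (Tq j).1) contracted_mass v)); last first.
    have : (#|J| * N.+1 + 1)%:R * th * total_cost <= th1 * total_cost by rewrite ler_wpM2r // ltW.
    rewrite natrD mulrDl mul1r mulrDl -mulrA => ?.
    by have := contracted_points_centers; lra.
  have E1 : \sum_k contracted_mass (inr k) =
      \sum_i opt_dist i `^ z * \sum_k (contracted (inl i) (inr k))%:R.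
    by rewrite exchange_big/=; apply: eq_bigr => i _; rewrite mulr_sumr.
  have E2 : \sum_j \sum_(v in (Tq j).1) contracted_mass v =
      \sum_i opt_dist i `^ z * \sum_j \sum_(v in (Tq j).1) (contracted (inl i) v)%:R.
    transitivity (\sum_j \sum_i \sum_(v in (Tq j).1) opt_dist i `^ z * (contracted (inl i) v)%:R).
      by apply: eq_bigr => j _; rewrite exchange_big.
    rewrite exchange_big/=; apply: eq_bigr => i _.
    by rewrite mulr_sumr; apply: eq_bigr => j _; rewrite mulr_sumr.
  rewrite E1 E2 -!big_split/=; apply: ler_sum => i _.
  rewrite -!mulrDr ler_wpM2l ?powR_ge0 //.
  under [X in _ <= _ + X]eq_bigr do rewrite -natr_sum.
  rewrite -!natr_sum -!natrD ler_nat.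
  rewrite /B; have [li|] := boolP (light (inl i)) => /=; last first.
    rewrite negb_and -ltNge => /orP[-> //|/forallPn[k]]; rewrite negbK => ik.
    by rewrite (bigD1 k) //= ik; case: (_ < _).
  case: exists_inP => [[v vT iv]|//].
  rewrite (bigD1 (tau i)) //= (bigD1 v) //= iv.
  by apply: leq_trans (leq_addl _ _); rewrite -addnA leq_addr.
have dB i : l2norm (x i - (Tq (tau i)).2) <=
    lift_factor * l2norm (fx i - c' (tau i)) + (B i)%:R * (opt_dist i + lift_factor * image_dist i).
  have [_ _ Hc Hx] := HTq (tau i).
  have [iB|] := boolP (B i); last first.
    rewrite /B negb_or negbK => /andP[li /exists_inPn nb].
    by rewrite mul0r addr0; exact: Hx.
  rewrite mul1r; apply: le_trans (l2norm_triangleB _ (c (sg i)) _) _.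
  have := Hc (sg i).
  have : lift_factor * l2norm (fc (sg i) - c' (tau i)) <=
      lift_factor * (image_dist i + l2norm (fx i - c' (tau i))).
    rewrite ler_wpM2l //; apply: le_trans (l2norm_triangleB _ (fx i) _) _.
    by rewrite /image_dist l2normBC.
  by rewrite /opt_dist; lra.
have image_dist_le i : (B i)%:R * image_dist i `^ z <=
    2 `^ z * (opt_dist i `^ z * (B i)%:R) + excess i.
  have : image_dist i `^ z - ((1 + e) * opt_dist i) `^ z <= excess i.
    by rewrite /excess le_max lexx orbT.
  have : ((1 + e) * opt_dist i) `^ z <= (2 * opt_dist i) `^ z.
    by apply: powR_le; rewrite ?mulr_ge0 ?ler_wpM2r ?opt_dist_ge0 //; lra.
  rewrite (@powRM _ 2) ?opt_dist_ge0 ?image_dist_ge0 ?l2norm_ge0 //.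
  have : 0 <= excess i by rewrite /excess le_max lexx.
  by case: (B i); rewrite ?mul1r ?mulr1 ?mul0r ?mulr0; lra.
have ei_ge1 : 1 <= e^-1 by rewrite -[leLHS]invr1 lef_pV2 ?posrE ?ltr01 //; lra.
(* The outer split costs [1 + e^-1 <= 2 / e] on the detour. The inner one, with parameter 1, costs 2
   on [opt_dist] and [2 * lift_factor <= 4] on [image_dist], which [image_dist_le] returns to
   [opt_dist] at a further factor 2. Hence [16 / e = (2 / e) * 8]. *)
have term i : l2norm (x i - (Tq (tau i)).2) `^ z <=
    ((1 + e) * lift_factor) `^ z * l2norm (fx i - c' (tau i)) `^ z +
    (16 / e) `^ z * (2 * (opt_dist i `^ z * (B i)%:R) + excess i).
  have rf0 : 0 <= opt_dist i + lift_factor * image_dist i.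
    by apply: addr_ge0; [exact: opt_dist_ge0|apply: mulr_ge0 => //; exact: image_dist_ge0].
  apply: le_trans (powR_le z0 (l2norm_ge0 _) (dB i)) _.
  have gs0 : 0 <= lift_factor * l2norm (fx i - c' (tau i)).
    by apply: mulr_ge0 => //; exact: l2norm_ge0.
  have br0 : 0 <= (B i)%:R * (opt_dist i + lift_factor * image_dist i) by apply: mulr_ge0.
  have eg0 : 0 <= (1 + e) * lift_factor by apply: mulr_ge0 => //; lra.
  apply: le_trans (powRD_le_split e0 z0 gs0 br0) _.
  rewrite mulrA (powRM _ eg0) ?l2norm_ge0 //.
  rewrite lerD2l.
  have [iB|iB] := boolP (B i); last first.
    rewrite mul0r mulr0 powR0 ?gt_eqF //; last by lra.
    by rewrite mulr0 mulr0 add0r mulr_ge0 ?powR_ge0 // /excess le_max lexx.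
  rewrite mul1r mulr1.
  have -> : 16 / e = (2 / e) * 8 by field; rewrite gt_eqF.
  rewrite (@powRM _ (1 + e^-1)) //; last by lra.
  rewrite (@powRM _ (2 / e)) ?divr_ge0 ?(ltW e0) // -mulrA.
  apply: ler_pM; rewrite ?powR_ge0 //.
    by apply: powR_le; lra.
  have gf0 : 0 <= lift_factor * image_dist i by apply: mulr_ge0 => //; exact: image_dist_ge0.
  have g20 : 0 <= (1 + 1) * lift_factor by apply: mulr_ge0.
  apply: le_trans (powRD_le_split ltr01 z0 (opt_dist_ge0 i) gf0) _.
  rewrite invr1 (@powRM _ _ (opt_dist i)) ?opt_dist_ge0 //.
  rewrite mulrA (powRM _ g20) ?image_dist_ge0 //.
  have := image_dist_le i; rewrite iB mul1r mulr1 => fi.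
  have p2 : 0 <= (2 : R) `^ z by exact: powR_ge0.
  have p4 : 0 <= (4 : R) `^ z by exact: powR_ge0.
  have p8 : (8 : R) `^ z = 4 `^ z * 2 `^ z by rewrite -powRM // -natrM.
  have p24 : (2 : R) `^ z <= 4 `^ z by apply: powR_le => //; rewrite ler_nat.
  have p21 : 1 <= (2 : R) `^ z by apply: powR_ge1 => //; rewrite ler1n.
  have pg : ((1 + 1) * lift_factor) `^ z <= 4 `^ z.
    by apply: powR_le => //; lra.
  have r0 : 0 <= opt_dist i `^ z by exact: powR_ge0.
  have x0 : 0 <= excess i by rewrite /excess le_max lexx.
  have : ((1 + 1) * lift_factor) `^ z * image_dist i `^ z <=
      4 `^ z * (2 `^ z * opt_dist i `^ z + excess i).
    by apply: ler_pM; rewrite ?powR_ge0.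
  have -> : (1 + 1 : R) = 2 by [].
  have : 2 `^ z * opt_dist i `^ z <= 4 `^ z * 2 `^ z * opt_dist i `^ z.
    by rewrite ler_wpM2r // ler_peMl //; lra.
  have : 4 `^ z * excess i <= 4 `^ z * 2 `^ z * excess i.
    by rewrite ler_wpM2r // ler_peMr.
  by rewrite p8; lra.
apply: le_trans (ler_sum _ (fun i _ => term i)) _.
rewrite big_split/= -!mulr_sumr lerD2l big_split/= -mulr_sumr.
(* The bad mass [2 * th1] enters twice and the excess adds [th1], which makes 5. With [5 <= 5 ^ z]
   and [th1 <= (e ^ 3) ^ z] the base becomes [80 e^2], at most [e] because [e <= 1 / 128]. *)
apply: (@le_trans _ _ ((16 / e) `^ z * (5 * th1 * total_cost))).
  by apply: ler_wpM2l; rewrite ?powR_ge0 //; have := excess_le; lra.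
rewrite mulrA ler_wpM2r ?(ltW O_gt0) //.
have th1e : th1 <= (e ^+ 3) `^ z by rewrite -powR_mulrn ?(ltW e0) // -powRrM.
apply: (@le_trans _ _ ((16 / e) `^ z * (5 `^ z * (e ^+ 3) `^ z))).
  rewrite ler_wpM2l ?powR_ge0 //; apply: ler_pM => //.
  by apply: powR_ge_base => //; rewrite ler1n.
have e30 : 0 <= e ^+ 3 by rewrite exprn_ge0 // ltW.
rewrite -!powRM ?mulr_ge0 ?invr_ge0 ?(ltW e0) //; apply: powR_le => //.
  by rewrite !mulr_ge0 ?invr_ge0 ?(ltW e0).
have -> : 16 / e * (5 * e ^+ 3) = 80 * e * e by field; rewrite gt_eqF.
by nra.
Qed.

(** The images of the optimal centers serve as centers. The excess costs at most [e ^ z], and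
    superadditivity of the power merges it with [(1 + e) ^ z]. *)
Lemma robust_upper : \sum_i image_dist i `^ z <= (1 + 2 * e) `^ z * total_cost.
Proof.
have [z1' [e0' es']] := conj z1 (conj e0 e_small).
apply: (@le_trans _ _ (\sum_i (((1 + e) * opt_dist i) `^ z + excess i))).
  apply: ler_sum => i _; rewrite -lerBlDl /excess le_max lexx orbT //.
rewrite big_split/=; apply: (@le_trans _ _ ((1 + e) `^ z * total_cost + e `^ z * total_cost)).
  apply: lerD.
    rewrite mulr_sumr; apply: ler_sum => i _.
    by rewrite powRM ?opt_dist_ge0 ?image_dist_ge0 ?l2norm_ge0 //; lra.
  apply: le_trans excess_le _; rewrite ler_wpM2r ?(ltW O_gt0) //.
  by apply: le_trans th1_le _; apply: ger_powR; rewrite ?e0; lra.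
rewrite -mulrDl ler_wpM2r ?(ltW O_gt0) //.
have -> : 1 + 2 * e = (1 + e) + e by ring.
by apply: powR_superadd => //; lra.
Qed.

End Robust.

(** * Gaussian integrals *)

Section Density.
Local Open Scope ereal_scope.
Context (d : measure_display) (T : measurableType d) (R : realType).
Variables (mu nu : {measure set T -> \bar R}) (h : T -> R).
Hypothesis (h0 : forall x, (0 <= h x)%R) (mh : measurable_fun setT h).
Hypothesis nuE : forall A, measurable A -> nu A = \int[mu]_(x in A) (h x)%:E.

Import HBNNSimple.

Let integral_density_nnsfun (f : {nnsfun T >-> R}) :
  \int[nu]_x (f x)%:E = \int[mu]_x ((f x)%:E * (h x)%:E).
Proof.
under [LHS]eq_integral do rewrite fimfunE -fsumEFin//.
rewrite [LHS]ge0_integral_fsum//; last 2 first.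
  - by move=> r; exact/measurable_EFinP/measurableT_comp.
  - by move=> n x _; rewrite EFinM nnfun_muleindic_ge0.
under [RHS]eq_integral.
  move=> x xD; rewrite fimfunE -fsumEFin// ge0_mule_fsuml; last first.
    by move=> r; rewrite EFinM nnfun_muleindic_ge0.
  over.
have mfh r : measurable_fun [set: T] (fun x => (\1_(f @^-1` [set r]) x)%:E * (h x)%:E).
  by apply: emeasurable_funM; exact/measurable_EFinP.
rewrite [RHS]ge0_integral_fsum//; last 2 first.
  - move=> r; apply: emeasurable_funM; exact/measurable_EFinP/measurableT_comp.
  - by move=> n x _; apply: mule_ge0; [rewrite EFinM nnfun_muleindic_ge0|rewrite lee_fin].
apply: eq_fsbigr => r _; rewrite integralZl_indic_nnsfun//.
have [r0|r0] := ltP r 0%R.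
  rewrite preimage_nnfun0// integral_indic// set0I measure0 mule0.
  by rewrite integral0_eq// => x _; rewrite indic0 mulr0 mul0e.
under [RHS]eq_integral do rewrite EFinM -muleA.
rewrite ge0_integralZl//; last first.
  by move=> x _; rewrite mule_ge0 ?lee_fin.
rewrite integral_indic// setIT nuE// [in LHS]integral_mkcond; congr (_ * _).
apply: eq_integral => x _; rewrite epatch_indic muleC.
by rewrite indicE.
Qed.

(** Monotone convergence from simple functions, for which [nuE] settles each indicator. *)
Lemma ge0_integral_density (f : T -> \bar R) :
  measurable_fun setT f -> (forall x, 0 <= f x) ->
  \int[nu]_x f x = \int[mu]_x (f x * (h x)%:E).
Proof.
move=> mf f0; pose f_ := nnsfun_approx measurableT mf.
transitivity (limn (fun n => \int[nu]_x (f_ n x)%:E)).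
  rewrite -monotone_convergence//=.
  - apply: eq_integral => x _; apply/esym/cvg_lim => //=.
    exact: cvg_nnsfun_approx.
  - by move=> n; apply: measurableT_comp.
  - by move=> n x _; rewrite lee_fin.
  - by move=> x _ a b ab; rewrite lee_fin//; exact/lefP/nd_nnsfun_approx.
under eq_fun do rewrite integral_density_nnsfun.
rewrite -monotone_convergence//=.
- apply: eq_integral => x _; apply/cvg_lim => //=.
  apply: cvgeZr => //; exact: cvg_nnsfun_approx.
- by move=> n; apply: emeasurable_funM; exact/measurable_EFinP.
- by move=> n x _; rewrite mule_ge0 ?lee_fin.
- move=> x _ a b ab; rewrite lee_wpmul2r ?lee_fin//; exact/lefP/nd_nnsfun_approx.
Qed.

End Density.

Section GaussianIntegral.
Context {R : realType}.
Implicit Types (sg s a v : R).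

Lemma measurable_expR_sqr s a v :
  measurable_fun setT (fun x : R => expR (- (s * (a + v * x) ^+ 2))).
Proof.
apply: measurableT_comp => //; apply: measurableT_comp => //.
apply: measurable_funM => //; apply: measurable_funX => //.
by apply: measurable_funD => //; exact: measurable_funM.
Qed.

(* Completing the square; [D = 1 + 2 s sg^2 v^2] is the ratio of the old to the new variance. *)
Lemma normal_exponentE sg s a v x (D := 1 + 2 * s * sg ^+ 2 * v ^+ 2) : sg != 0 -> D != 0 ->
  - (s * (a + v * x) ^+ 2) + - (x - 0) ^+ 2 / (sg ^+ 2 *+ 2) =
  - (s / D * a ^+ 2) +
  - (x + 2 * s * a * v * (sg ^+ 2 / D)) ^+ 2 / (sg ^+ 2 / D *+ 2).
Proof.
move=> sg0 D0; have S0 : sg ^+ 2 != 0 by rewrite expf_neq0.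
set S := sg ^+ 2 in S0 *; set u := S / D; rewrite subr0.
have u0 : u != 0 by rewrite mulf_neq0 ?invr_eq0.
pose k := (S *+ 2)^-1; pose A := k + s * v ^+ 2.
have uA : (u *+ 2)^-1 = A.
  by rewrite /A /k /u /D -/S; field; rewrite S0 -/D D0.
have H1 : 2 * u * A = 1 by rewrite -uA mulr_natl divff // mulrn_eq0 negb_or.
have H2 : D^-1 = 1 - 2 * s * v ^+ 2 * u by rewrite /u /D -/S; field; rewrite -/D.
rewrite -/k uA H2.
have -> : - (x + 2 * s * a * v * u) ^+ 2 * A =
    - (x ^+ 2 * A) - (2 * u * A) * (2 * s * a * v * x + 2 * s ^+ 2 * a ^+ 2 * v ^+ 2 * u).
  by ring.
by rewrite H1 /A; ring.
Qed.

(** After completing the square the integrand is a constant times another normal density. Negative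
    [s] is allowed while the variance ratio stays positive; the upper tail relies on this. *)
Lemma normal_integral_expR_sqr sg s a v :
  0 < sg -> 0 < 1 + 2 * s * sg ^+ 2 * v ^+ 2 ->
  (\int[normal_prob 0 sg]_x (expR (- (s * (a + v * x) ^+ 2)))%:E =
   ((Num.sqrt (1 + 2 * s * sg ^+ 2 * v ^+ 2))^-1 *
    expR (- (s / (1 + 2 * s * sg ^+ 2 * v ^+ 2) * a ^+ 2)))%:E)%E.
Proof.
move=> sg0; set D := 1 + _ => D0.
have sgN0 : sg != 0 by rewrite gt_eqF.
rewrite (@ge0_integral_density _ _ _ lebesgue_measure _ (normal_pdf 0 sg)); last 5 first.
- exact: normal_pdf_ge0.
- exact: measurable_normal_pdf.
- by [].
- by apply/measurable_EFinP; exact: measurable_expR_sqr.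
- by move=> x; rewrite lee_fin expR_ge0.
pose q := Num.sqrt D; have q0 : 0 < q by rewrite sqrtr_gt0.
have q2 : q ^+ 2 = D by rewrite sqr_sqrtr // ltW.
pose sg' := sg / q; have sg'0 : 0 < sg' by rewrite divr_gt0.
pose m := - (2 * s * a * v * sg' ^+ 2).
have E x : expR (- (s * (a + v * x) ^+ 2)) * normal_pdf 0 sg x =
    (q^-1 * expR (- (s / D * a ^+ 2))) * normal_pdf m sg' x.
  rewrite !normal_pdfE ?gt_eqF // /normal_peak /normal_fun.
  have -> : sg' ^+ 2 * pi *+ 2 = (sg ^+ 2 * pi *+ 2) * (q ^+ 2)^-1.
    by rewrite /sg' expr_div_n -!mulrnAl mulrAC.
  rewrite sqrtrM; last by rewrite mulrn_wge0 // mulr_ge0 ?sqr_ge0 ?pi_ge0.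
  rewrite sqrtrV ?sqr_ge0 // sqrtr_sqr (ger0_norm (ltW q0)) invfM invrK.
  set p := (Num.sqrt _)^-1.
  have DN0 : D != 0 by rewrite gt_eqF.
  rewrite [LHS]mulrCA -expRD (@normal_exponentE sg s a v x sgN0 DN0) -/D.
  rewrite expRD /m /sg' expr_div_n q2 opprK.
  by set e1 := expR _; set e2 := expR _; field; rewrite gt_eqF.
under eq_integral do rewrite -EFinM E EFinM.
rewrite ge0_integralZl//.
- by rewrite integral_normal_pdf mule1.
- by apply/measurable_EFinP; exact: measurable_normal_pdf.
- by move=> x _; rewrite lee_fin normal_pdf_ge0.
- by rewrite lee_fin mulr_ge0 ?expR_ge0 ?invr_ge0 ?(ltW q0).
Qed.

End GaussianIntegral.

(** * Independence *)

Section Independence.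
Local Open Scope ereal_scope.
Context {R : realType} {d : measure_display} {T : measurableType d}.
Variables (P : probability T R) (I : finType) (X : I -> {RV P >-> R}).
Hypothesis indX : mutually_independent X.

Definition cylinder (J : {set I}) (B : I -> set R) : set T :=
  \bigcap_(i in [set` J]) (X i @^-1` B i).

(** Independence of [Z] from the family [X i], [i] in [J], is tested on cylinders only; no
    sigma-algebra generated by the family has to be formed. *)
Definition independent_of (d' : measure_display) (E : measurableType d')
    (Z : T -> E) (J : {set I}) : Prop :=
  forall A B, measurable A -> (forall i, measurable (B i)) ->
    P (Z @^-1` A `&` cylinder J B) = P (Z @^-1` A) * P (cylinder J B).

Lemma measurable_cylinder J B : (forall i, measurable (B i)) -> measurable (cylinder J B).
Proof.
move=> mB; apply: fin_bigcap_measurable => // i _.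
by rewrite -[X in measurable X]setTI; exact: measurable_funP.
Qed.

Lemma cylinderU1 j (J : {set I}) B : j \notin J ->
  cylinder (j |: J)%SET B = X j @^-1` B j `&` cylinder J B.
Proof.
move=> jJ; rewrite /cylinder; apply/seteqP; split => [w H|w [Hj H] i].
  split; first by apply: (H j); rewrite /= finset.setU11.
  by move=> i iJ; apply: (H i); rewrite /= finset.in_setU iJ orbT.
by rewrite /= => /finset.setU1P[->//|iJ]; exact: H.
Qed.

Lemma prob_cylinderU1 j (J : {set I}) B : (forall i, measurable (B i)) -> j \notin J ->
  P (cylinder (j |: J)%SET B) = P (X j @^-1` B j) * P (cylinder J B).
Proof. by move=> mB jJ; rewrite /cylinder !indX // big_setU1. Qed.

Lemma independent_of_cst (d' : measure_display) (E : measurableType d') (z : E) J :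
  independent_of (fun=> z) J.
Proof.
move=> A B mA mB; rewrite preimage_cst; case: ifPn => _.
  by rewrite setTI probability_setT mul1e.
by rewrite set0I measure0 mul0e.
Qed.

Lemma independent_of_comp (d1 d2 : measure_display) (E : measurableType d1)
    (F : measurableType d2) (Z : T -> E) (phi : E -> F) J :
  measurable_fun setT phi -> independent_of Z J -> independent_of (phi \o Z) J.
Proof.
move=> mphi ind A B mA mB; rewrite comp_preimage; apply: ind => //.
by rewrite -[X in measurable X]setTI; exact: mphi.
Qed.

Section Extend.
Context {d' : measure_display} {E : measurableType d'}.
Variables (Z : T -> E) (j : I) (J : {set I}).
Hypotheses (mZ : measurable_fun setT Z) (jJ : j \notin J).
Hypothesis indZ : independent_of Z (j |: J)%SET.

Let pairZ : T -> E * R := fun w => (Z w, X j w).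

Let mpair : measurable_fun setT pairZ.
Proof. by apply/measurable_fun_pairP; split. Qed.

Let Zm : {mfun T >-> E} := HB.pack Z (isMeasurableFun.Build _ _ _ _ Z mZ).
Let pairm : {mfun T >-> (E * R)%type} :=
  HB.pack pairZ (isMeasurableFun.Build _ _ _ _ pairZ mpair).

(** Writing [A2] into slot [j] of [B] turns the condition on [X j] into part of a cylinder over
    [j |: J], where [indZ] applies. *)
Let prob_rect A1 A2 B : measurable A1 -> measurable A2 -> (forall i, measurable (B i)) ->
  P (pairZ @^-1` (A1 `*` A2) `&` cylinder J B) =
  P (Z @^-1` A1) * P (X j @^-1` A2) * P (cylinder J B).
Proof.
move=> mA1 mA2 mB; pose B' i := if i == j then A2 else B i.
have mB' i : measurable (B' i) by rewrite /B'; case: ifP.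
have BB' : cylinder J B = cylinder J B'.
  apply: eq_bigcapr => i /= iJ; rewrite /B'; case: eqP => // ij.
  by move: jJ; rewrite -ij iJ.
have B'j : B' j = A2 by rewrite /B' eqxx.
rewrite BB' -muleA -{2}B'j -prob_cylinderU1 // -indZ //.
by rewrite cylinderU1 // B'j setIA.
Qed.

(** The law of the pair agrees with the product of the laws on rectangles, hence everywhere;
    Tonelli's theorem does the rest. *)
Lemma integral_independent_pair (f : E * R -> \bar R) :
  measurable_fun setT f -> (forall x, 0 <= f x) ->
  \int[P]_w f (Z w, X j w) = \int[P]_w \int[distribution P (X j)]_x f (Z w, x).
Proof.
move=> mf f0.
have law A : measurable A -> (distribution P Zm \x distribution P (X j)) A = distribution P pairm A.
  apply: product_measure_unique => A1 A2 mA1 mA2.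
  have := @prob_rect A1 A2 (fun=> setT) mA1 mA2 (fun=> measurableT).
  have -> : cylinder J (fun=> setT) = setT.
    by rewrite -subTset => w _ i.
  by rewrite setIT probability_setT mule1.
rewrite -[LHS](@ge0_integral_distribution _ _ _ _ _ P pairm f) //.
transitivity (\int[(distribution P Zm \x distribution P (X j))%E]_x f x).
  by apply: eq_measure_integral => A mA _; symmetry; exact: law.
rewrite fubini_tonelli1 //.
rewrite (@ge0_integral_distribution _ _ _ _ _ P Zm) //.
- exact: measurable_fun_fubini_tonelli_F.
- by move=> z; apply: integral_ge0.
Qed.

(** For a fixed cylinder both sides are finite measures in [A] that agree on rectangles, a
    generating class closed under intersection. This lets an induction absorb one variable at a
    time. *)
Lemma independent_of_pair : independent_of pairZ J.
Proof.
move=> A B mA mB; have mD := measurable_cylinder J mB.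
pose D := cylinder J B.
have PD : (0 <= fine (P D))%R by apply: fine_ge0.
pose m1 : {measure set (E * R) -> \bar R} := pushforward (mrestr P mD) pairm.
pose m2 : {measure set (E * R) -> \bar R} := mscale (NngNum PD) (distribution P pairm).
have : m1 mpair A = m2 A.
  apply: (measure_unique [set A1 `*` A2 | A1 in measurable & A2 in measurable] (fun=> setT)) => //.
  - exact: measurable_prod_measurableType.
  - move=> _ _ [A1 mA1 [A2 mA2 <-]] [B1 mB1 [B2 mB2 <-]].
    exists (A1 `&` B1); first exact: measurableI.
    by exists (A2 `&` B2); [exact: measurableI|rewrite setXI].
  - by move=> _; exists setT => //; exists setT => //; rewrite setXTT.
  - by apply/seteqP; split => // x _; exists 0%N.
  - move=> _ [A1 mA1 [A2 mA2 <-]]; rewrite /m1 /m2 /= /pushforward /mrestr /mscale /=.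
    rewrite prob_rect // /distribution /pushforward.
    have := @prob_rect A1 A2 (fun=> setT) mA1 mA2 (fun=> measurableT).
    have -> : cylinder J (fun=> setT) = setT by rewrite -subTset => w _ i.
    rewrite setIT probability_setT mule1 => ->.
    by rewrite muleC fineK // fin_num_measure.
  - move=> _; rewrite /m1 /= /pushforward /mrestr /=.
    by apply: le_lt_trans (ltry 1); apply: probability_le1; rewrite preimage_setT setTI; exact: mD.
rewrite /m1 /m2 /= /pushforward /mrestr /mscale /= => ->.
by rewrite muleC fineK // fin_num_measure.
Qed.

End Extend.
End Independence.

(** * The Laplace transform of a Gaussian image *)

(* [normal_prob] lives on [measurableTypeR R], which carries the same sigma-algebra
   as [R] but has another display; the identity between them transfers integrals. *)
Section GaussianVariable.
Local Open Scope ereal_scope.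
Context {R : realType} {d : measure_display} {T : measurableType d}.
Variable P : probability T R.

Let idTR : measurableTypeR R -> R := idfun.

#[local] HB.instance Definition _ :=
  @isMeasurableFun.Build _ _ _ _ idTR (@measurable_id _ _ setT).

Lemma integral_gaussian (Y : {RV P >-> R}) (m s : R) (f : R -> \bar R) :
  (forall B : set R, measurable B -> distribution P Y B = normal_prob m s B) ->
  measurable_fun setT f -> (forall x, 0 <= f x) ->
  \int[distribution P Y]_x f x = \int[normal_prob m s]_x f x.
Proof.
move=> YN mf f0.
transitivity (\int[distribution (normal_prob m s) (idTR : {RV (normal_prob m s) >-> R})]_x f x).
  by apply: eq_measure_integral => A mA _; exact: YN.
by rewrite ge0_integral_distribution.
Qed.

End GaussianVariable.

Section GaussianMap.
Context {R : realType} {d : measure_display} {T : measurableType d}.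
Variables (P : probability T R) (t n : nat) (G : 'I_t -> 'I_n -> {RV P >-> R}).
Hypothesis (iidG : iid_gaussian_entries G) (t0 : (0 < t)%N).
Variable v : 'cV[R]_n.

Let X (ij : 'I_t * 'I_n) := G ij.1 ij.2.
Let sg : R := (Num.sqrt t%:R)^-1.

Let sg0 : 0 < sg.
Proof. by rewrite invr_gt0 sqrtr_gt0 ltr0n. Qed.

Let sg2 : sg ^+ 2 = t%:R^-1.
Proof. by rewrite exprVn sqr_sqrtr. Qed.

Let rowsum (i : 'I_t) (m : nat) (w : T) : R := \sum_(j < n | (j < m)%N) v j ord0 * G i j w.
Let rowsq (k : nat) (w : T) : R := \sum_(i < t | (i < k)%N) rowsum i n w ^+ 2.
Let vsq (m : nat) : R := \sum_(j < n | (j < m)%N) v j ord0 ^+ 2.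
(** Entries are read row by row, from left to right: the pair holds the squares of the finished rows
    and the partial sum of row [i], while [rest] holds the unread entries. *)
Let state (i : 'I_t) (m : nat) (w : T) : R * R := (rowsq i w, rowsum i m w).
Let rest (i : 'I_t) (m : nat) : {set 'I_t * 'I_n} :=
  finset.finset (fun kj : 'I_t * 'I_n => (i < kj.1)%N || ((kj.1 == i) && (m <= kj.2)%N)).

Lemma sum_ord_ltS (F : 'I_n -> R) (m : 'I_n) :
  \sum_(j < n | (j < m.+1)%N) F j = \sum_(j < n | (j < m)%N) F j + F m.
Proof.
rewrite (bigD1 m) /= ?ltnS // addrC; congr (_ + _); apply: eq_bigl => j.
by rewrite ltnS ltn_neqAle -val_eqE andbC.
Qed.

Let rowsumS i (m : 'I_n) w : rowsum i m.+1 w = rowsum i m w + v m ord0 * G i m w.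
Proof. by rewrite /rowsum sum_ord_ltS. Qed.

Let rowsum0 i w : rowsum i 0 w = 0.
Proof. by rewrite /rowsum big_pred0. Qed.

Let rowsqS (i : 'I_t) w : rowsq i.+1 w = rowsq i w + rowsum i n w ^+ 2.
Proof.
rewrite /rowsq (bigD1 i) /= ?ltnS // addrC; congr (_ + _); apply: eq_bigl => j.
by rewrite ltnS ltn_neqAle -val_eqE andbC.
Qed.

Lemma sqn_random_map w : sqn (random_map G w v) = rowsq t w.
Proof.
rewrite /sqn /dotp /rowsq; apply: eq_big => [i|i _]; first by rewrite ltn_ord.
rewrite expr2 !mxE; congr (_ * _); apply: eq_big => [j|j _]; rewrite ?ltn_ord //.
  by rewrite mxE mulrC.
by rewrite mxE mulrC.
Qed.

Let mrowsum i m : measurable_fun setT (rowsum i m).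
Proof.
rewrite /rowsum; under eq_fun do rewrite big_mkcond/=.
by apply: measurable_sum => j; case: (j < m)%N => //; exact: measurable_funM.
Qed.

Let mrowsq k : measurable_fun setT (rowsq k).
Proof.
rewrite /rowsq; under eq_fun do rewrite big_mkcond/=.
by apply: measurable_sum => i; case: (i < k)%N => //; exact: measurable_funX.
Qed.

Let mstate i m : measurable_fun setT (state i m).
Proof. exact: measurable_fun_pair (mrowsq i) (mrowsum i m). Qed.

Let independent_state_row (i : 'I_t) (m : nat) : (m <= n)%N ->
  independent_of X (state i 0) (rest i 0) -> independent_of X (state i m) (rest i m).
Proof.
move=> + ind0; elim: m => [//|m IH] mn; have {}IH := IH (ltnW mn).
pose m' := Ordinal mn.
have -> : state i m.+1 = (fun z : (R * R) * R => (z.1.1, z.1.2 + v m' ord0 * z.2)) \o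
    (fun w => (state i m w, X (i, m') w)).
  by apply/funext => w; congr (_, _); exact: (rowsumS i m' w).
apply: independent_of_comp.
  apply: measurable_fun_pair; first exact: (measurableT_comp measurable_fst measurable_fst).
  apply: measurable_funD; first exact: (measurableT_comp measurable_snd measurable_fst).
  by apply: measurable_funM => //; exact: measurable_snd.
have restE : rest i m = ((i, m') |: rest i m.+1)%SET.
  apply/setP => -[k j]; rewrite !finset.inE /= xpair_eqE -(val_eqE j) /=.
  case: (ltngtP i k) => [ik|ki|ik] /=.
  - by rewrite orbT.
  - by have -> : (k == i) = false by apply/eqP => e; move: ki; rewrite e ltnn.
  - have -> : k == i by rewrite -val_eqE /= ik.
    by rewrite /= leq_eqVlt eq_sym.
apply: independent_of_pair => //.
- exact: iidG.1.
- by rewrite !finset.inE /= ltnn eqxx /= ltnn.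
- by rewrite -restE.
Qed.

(** At the end of a row its sum is squared into the first component. The new state is a measurable
    function of the old one, so independence persists. *)
Let independent_state (i : 'I_t) : independent_of X (state i 0) (rest i 0).
Proof.
case: i => i; elim: i => [|i IH] it.
  have -> : state (Ordinal it) 0 = fun=> (0, 0).
    by apply/funext => w; rewrite /state rowsum0 /rowsq big_pred0.
  exact: independent_of_cst.
have it' := ltnW it; have := independent_state_row (leqnn n) (IH it').
set i' := Ordinal it' => ind.
have -> : state (Ordinal it) 0 = (fun z : R * R => (z.1 + z.2 ^+ 2, 0)) \o state i' n.
  by apply/funext => w; rewrite /state /= rowsum0 (rowsqS i').
apply: independent_of_comp.
  apply: measurable_fun_pair => //; apply: measurable_funD; first exact: measurable_fst.
  by apply: measurable_funX; exact: measurable_snd.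
have -> // : rest (Ordinal it) 0 = rest i' n.
apply/setP => -[k j]; rewrite !finset.inE /=.
have -> : (n <= j)%N = false by rewrite leqNgt ltn_ord.
by rewrite andbF orbF andbT -val_eqE /= [RHS]leq_eqVlt eq_sym orbC.
Qed.

(* Integrating out one entry [g] turns [exp (- s (a + u g) ^ 2)] into a multiple of
   [exp (- s' a ^ 2)], so the induction is on the number of columns, for all [s] at once. *)
Let row_laplace (i : 'I_t) (kap : R) (m : nat) : (m <= n)%N -> forall s,
  0 < 1 + 2 * s * sg ^+ 2 * vsq m ->
  (\int[P]_w (expR (- (kap * rowsq i w)) * expR (- (s * rowsum i m w ^+ 2)))%:E =
   ((Num.sqrt (1 + 2 * s * sg ^+ 2 * vsq m))^-1)%:E *
   \int[P]_w (expR (- (kap * rowsq i w)))%:E)%E.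
Proof.
elim: m => [_ s _|m IH mn s].
  rewrite /vsq big_pred0 // mulr0 addr0 sqrtr1 invr1 mul1e.
  by apply: eq_integral => w _; rewrite rowsum0 expr0n mulr0 oppr0 expR0 mulr1.
pose m' := Ordinal mn.
have vsqE : vsq m.+1 = vsq m + v m' ord0 ^+ 2 by rewrite /vsq (sum_ord_ltS _ m').
have vm0 : 0 <= vsq m by apply: sumr_ge0 => j _; exact: sqr_ge0.
have v20 : 0 <= v m' ord0 ^+ 2 by exact: sqr_ge0.
have sg20 : 0 < sg ^+ 2 by rewrite exprn_gt0.
rewrite vsqE; set V := vsq m in vm0 *; set u := v m' ord0 in v20 *.
move=> pos; pose D := 1 + 2 * s * sg ^+ 2 * u ^+ 2.
(* For negative [s], dropping the nonnegative [V] can only increase the value, so [pos] still yields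
   positivity. *)
have D0 : 0 < D.
  have [s0|s0] := leP 0 s.
    have : 0 <= 2 * s * sg ^+ 2 * u ^+ 2.
      apply: mulr_ge0 => //; apply: mulr_ge0; last exact: ltW.
      by rewrite mulr_ge0.
    by rewrite /D; lra.
  apply: lt_le_trans pos _; rewrite /D lerD2l.
  by rewrite ler_wnM2l ?lerDr // pmulr_lle0 // pmulr_rle0 // ltW.
have pos' : 0 < 1 + 2 * (s / D) * sg ^+ 2 * V.
  have -> : 1 + 2 * (s / D) * sg ^+ 2 * V = (1 + 2 * s * sg ^+ 2 * (V + u ^+ 2)) / D.
    by rewrite /D; field; rewrite -/D gt_eqF.
  by rewrite divr_gt0.
pose f (z : (R * R) * R) : \bar R :=
  (expR (- (kap * z.1.1)) * expR (- (s * (z.1.2 + u * z.2) ^+ 2)))%:E.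
have mf : measurable_fun setT f.
  apply/measurable_EFinP; apply: measurable_funM.
    apply: measurableT_comp => //; apply: measurableT_comp => //.
    apply: measurable_funM => //.
    exact: (measurableT_comp measurable_fst measurable_fst).
  apply: measurableT_comp => //; apply: measurableT_comp => //.
  apply: measurable_funM => //; apply: measurable_funX.
  apply: measurable_funD; first exact: (measurableT_comp measurable_snd measurable_fst).
  by apply: measurable_funM => //; exact: measurable_snd.
have f0 z : (0 <= f z)%E by rewrite lee_fin mulr_ge0 ?expR_ge0.
have jJ : (i, m') \notin rest i m.+1 by rewrite !finset.inE /= ltnn eqxx /= ltnn.
have restE : rest i m = ((i, m') |: rest i m.+1)%SET.
  apply/setP => -[k j]; rewrite !finset.inE /= xpair_eqE -(val_eqE j) /=.
  case: (ltngtP i k) => [ik|ki|ik] /=.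
  - by rewrite orbT.
  - by have -> : (k == i) = false by apply/eqP => e; move: ki; rewrite e ltnn.
  - have -> : k == i by rewrite -val_eqE /= ik.
    by rewrite /= leq_eqVlt eq_sym.
have ind : independent_of X (state i m) ((i, m') |: rest i m.+1)%SET.
  by rewrite -restE; apply: independent_state_row; rewrite ?(ltnW mn).
transitivity (\int[P]_w f (state i m w, X (i, m') w))%E.
  by apply: eq_integral => w _; rewrite /f /= (rowsumS _ m').
rewrite (integral_independent_pair iidG.1 (@mstate i m) jJ ind mf f0).
transitivity (\int[P]_w ((Num.sqrt D)^-1%:E *
   (expR (- (kap * rowsq i w)) * expR (- (s / D * rowsum i m w ^+ 2)))%:E))%E.
  apply: eq_integral => w _.
  rewrite (integral_gaussian (iidG.2 i m')) //; last first.
    exact: measurableT_comp mf (measurable_pair1 _).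
  rewrite /f /=; under eq_integral do rewrite EFinM.
  rewrite ge0_integralZl ?lee_fin ?expR_ge0 //; last first.
  - by apply/measurable_EFinP; exact: measurable_expR_sqr.
  rewrite normal_integral_expR_sqr // -/D -!EFinM; congr (_%:E); by rewrite mulrCA.
rewrite ge0_integralZl //; last first.
- apply/measurable_EFinP; apply: measurable_funM.
    by do 2 apply: measurableT_comp => //; exact: measurable_funM.
  do 2 apply: measurableT_comp => //; apply: measurable_funM => //.
  exact: measurable_funX.
rewrite IH ?(ltnW mn) // muleA -EFinM; congr (_%:E * _)%E.
(* [D] times the factor of the induction hypothesis at [s / D] is [1 + 2 s sg^2 (V + u^2)]. *)
rewrite -invfM -sqrtrM ?(ltW D0) //; congr (Num.sqrt _)^-1.
by rewrite -/V /D; field; rewrite -/D gt_eqF.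
Qed.

(** This is the Laplace transform of [sqn v / t] times a chi-square variable with [t] degrees of
    freedom. Each row contributes one factor, by [row_laplace] at [s = kap]. *)
Lemma laplace_sqn_random_map (kap : R) : 0 < 1 + 2 * kap * sqn v / t%:R ->
  (\int[P]_w (expR (- (kap * sqn (random_map G w v))))%:E =
   ((Num.sqrt (1 + 2 * kap * sqn v / t%:R))^-1 ^+ t)%:E)%E.
Proof.
move=> pos.
have vE : vsq n = sqn v by apply: eq_big => [j|j _]; rewrite ?ltn_ord.
have H k : (k <= t)%N -> (\int[P]_w (expR (- (kap * rowsq k w)))%:E =
   ((Num.sqrt (1 + 2 * kap * sqn v / t%:R))^-1 ^+ k)%:E)%E.
  elim: k => [_|k IH kt].
    rewrite expr0 -(@probability_setT _ _ _ P) -[RHS]mul1e -integral_cst //.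
    by apply: eq_integral => w _; rewrite /rowsq big_pred0 // mulr0 oppr0 expR0.
  have E : 1 + 2 * kap * sg ^+ 2 * vsq n = 1 + 2 * kap * sqn v / t%:R.
    by rewrite sg2 vE; ring.
  have := @row_laplace (Ordinal kt) kap n (leqnn n) kap.
  rewrite E => /(_ pos) /=; rewrite IH ?(ltnW kt) // -EFinM -exprS => <-.
  apply: eq_integral => w _; rewrite (rowsqS (Ordinal kt)) -expRD /=.
  by congr (expR _)%:E; ring.
by under eq_integral do rewrite sqn_random_map; exact: H.
Qed.

End GaussianMap.

Lemma measurable_set_bool (d : measure_display) (T : measurableType d) (b : T -> bool) :
  measurable_fun setT b -> measurable [set w | b w].
Proof.
move=> mb; rewrite (_ : [set _ | _] = setT `&` b @^-1` [set true]); first exact: mb.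
by rewrite setTI.
Qed.

(** * Tail bounds for the norm of a Gaussian image *)

Section Tails.
Context {R : realType} {d : measure_display} {T : measurableType d}.
Variables (P : probability T R) (t n : nat) (G : 'I_t -> 'I_n -> {RV P >-> R}).

Lemma measurable_random_map_entry (v : 'cV[R]_n) (i : 'I_t) :
  measurable_fun setT (fun w => random_map G w v i ord0).
Proof.
rewrite /random_map; under eq_fun do rewrite mxE.
apply: measurable_sum => j; under eq_fun do rewrite mxE.
exact: measurable_funM.
Qed.

Lemma measurable_sqn_random_mapB (v : 'cV[R]_n) (c : 'cV[R]_t) :
  measurable_fun setT (fun w => sqn (random_map G w v - c)).
Proof.
rewrite /sqn /dotp; apply: measurable_sum => i.
have m : measurable_fun setT (fun w => (random_map G w v - c) i ord0).
  under eq_fun do rewrite mxE.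
  by apply: measurable_funD => //; exact: measurable_random_map_entry.
exact: measurable_funM.
Qed.

Lemma measurable_sqn_random_map (v : 'cV[R]_n) :
  measurable_fun setT (fun w => sqn (random_map G w v)).
Proof.
have := measurable_sqn_random_mapB v 0.
by under eq_fun do rewrite subr0.
Qed.

Lemma measurable_l2norm_random_map (v : 'cV[R]_n) :
  measurable_fun setT (fun w => l2norm (random_map G w v)).
Proof.
apply: measurableT_comp (measurable_sqn_random_map v).
by apply: continuous_measurable_fun; exact: sqrt_continuous.
Qed.

Lemma random_mapB w (u v : 'cV[R]_n) :
  random_map G w (u - v) = random_map G w u - random_map G w v.
Proof. exact: mulmxBr. Qed.

Hypothesis (iidG : iid_gaussian_entries G) (t0 : (0 < t)%N).

Let tR0 : 0 < t%:R :> R. Proof. by rewrite ltr0n. Qed.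

Lemma inv_sqrt_exp_le (D c : R) : 0 < D -> D^-1 <= expR c ->
  (Num.sqrt D)^-1 ^+ t <= expR (t%:R * c / 2).
Proof.
move=> D0 Dc; rewrite -sqrtrV ?(ltW D0) // -mulrA expRM_natl.
rewrite lerXn2r ?nnegrE ?sqrtr_ge0 ?expR_ge0 //.
rewrite -(@ler_pXn2r _ 2) ?nnegrE ?sqrtr_ge0 ?expR_ge0 //.
rewrite sqr_sqrtr ?invr_ge0 ?(ltW D0) // -expRM_natl.
by rewrite mulrC divfK.
Qed.

Lemma measurable_expR_sqn kap v :
  measurable_fun setT (fun w => (expR (- (kap * sqn (random_map G w v))))%:E).
Proof.
apply/measurable_EFinP; do 2 apply: measurableT_comp => //.
by apply: measurable_funM => //; exact: measurable_sqn_random_map.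
Qed.

(** Chernoff's method; [kap] may have either sign. *)
Lemma prob_le_laplace (A : set T) (v : 'cV[R]_n) (c kap : R) : measurable A ->
  0 <= c -> 0 < 1 + 2 * kap * sqn v / t%:R ->
  (forall w, A w -> 1 <= c * expR (- (kap * sqn (random_map G w v)))) ->
  (P A <= (c * (Num.sqrt (1 + 2 * kap * sqn v / t%:R))^-1 ^+ t)%:E)%E.
Proof.
move=> mA c0 pos H; rewrite EFinM -(laplace_sqn_random_map iidG t0 pos).
rewrite -ge0_integralZl //; last first.
- exact: measurable_expR_sqn.
have -> : P A = (\int[P]_w (\1_A w)%:E)%E by rewrite integral_indic // setIT.
apply: ge0_le_integral => //.
- exact/measurable_EFinP.
- by apply: measurable_funeM; exact: measurable_expR_sqn.
move=> w _; rewrite -EFinM lee_fin indicE.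
have [/set_mem /H //|_] := boolP (w \in A).
by rewrite mulr_ge0 ?expR_ge0.
Qed.

Lemma prob_contract_le (e : R) (v : 'cV[R]_n) : 0 < e -> e <= 1 ->
  (P [set w | ((1 + e) ^+ 2 * sqn (random_map G w v) < sqn v)%R]
   <= (expR (- (t%:R * e ^+ 2 / 8)))%:E)%E.
Proof.
move=> e0 e1.
have mA : measurable [set w | (1 + e) ^+ 2 * sqn (random_map G w v) < sqn v].
  apply: measurable_set_bool; apply: measurable_fun_ltr => //.
  by apply: measurable_funM => //; exact: measurable_sqn_random_map.
have [v0|vN0] := eqVneq (sqn v) 0.
  rewrite (_ : [set _ | _] = set0) ?measure0 ?lee_fin ?expR_ge0 //.
  rewrite -subset0 => w /=; rewrite v0 ltNge mulr_ge0 ?sqn_ge0 ?sqr_ge0 //.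
have v0 : 0 < sqn v by rewrite lt_neqAle eq_sym vN0 sqn_ge0.
(* This [kap] gives [1 + 2 * kap * sqn v / t = 1 + e] in the Laplace transform. *)
pose kap := t%:R * e / (2 * sqn v).
have kap0 : 0 <= kap by rewrite divr_ge0 ?mulr_ge0 // ltW.
have DE : 1 + 2 * kap * sqn v / t%:R = 1 + e by rewrite /kap; field; rewrite vN0 gt_eqF.
pose c := expR (kap * sqn v / (1 + e) ^+ 2).
apply: le_trans (@prob_le_laplace _ v c kap mA (expR_ge0 _) _ _) _.
- by rewrite DE addr_gt0.
- move=> w /= Aw; rewrite /c -expRD -[leLHS]expR0 ler_expR subr_ge0 -mulrA.
  by rewrite ler_wpM2l // ler_pdivlMr ?exprn_gt0 ?addr_gt0 // mulrC ltW.
rewrite lee_fin DE; apply: (@le_trans _ _ (c * expR (t%:R * (- (e / (1 + e))) / 2))).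
  rewrite ler_wpM2l ?expR_ge0 //; apply: inv_sqrt_exp_le; first by rewrite addr_gt0.
  rewrite [leLHS](_ : _ = 1 + - (e / (1 + e))); last by field; rewrite gt_eqF ?addr_gt0.
  exact: expR_ge1Dx.
rewrite /c -expRD ler_expR /kap.
have -> : t%:R * e / (2 * sqn v) * sqn v / (1 + e) ^+ 2 + t%:R * - (e / (1 + e)) / 2 =
   - (t%:R * e ^+ 2 / (2 * (1 + e) ^+ 2)).
  by field; rewrite vN0 gt_eqF ?addr_gt0.
rewrite lerN2; apply: ler_wpM2l; first by rewrite mulr_ge0 ?sqr_ge0 // ltW.
rewrite lef_pV2 ?posrE ?ltr0n //; last by rewrite mulr_gt0 ?exprn_gt0 ?addr_gt0.
by nra.
Qed.

(** Let [q] be the ratio of the image norm to [(1 + e) |v|]. Where [q > 1], [q ^ z <= exp (z (q -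
    1)) <= exp (a (q^2 - 1))] as soon as [z <= 2 a], which [z <= t e] guarantees. So the excess is
    dominated by an exponential with known mean. *)
Lemma integral_excess_le (e z : R) (v : 'cV[R]_n) : 0 < e -> e <= 1 -> 1 <= z ->
  z <= t%:R * e ->
  (\int[P]_w (Num.max 0 (l2norm (random_map G w v) `^ z - ((1 + e) * l2norm v) `^ z))%:E
   <= (((1 + e) * l2norm v) `^ z * expR (- (t%:R * e ^+ 2 / 2)))%:E)%E.
Proof.
move=> e0 e1 z1 zt; have z0 : 0 < z by lra.
have [v0|vN0] := eqVneq (l2norm v) 0.
  rewrite (l2norm_eq0 v0) /random_map.
  under eq_integral do rewrite mulmx0.
  rewrite !l2norm0 mulr0 powR0 ?gt_eqF // subr0 maxxx mul0r.
  by rewrite integral0.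
have v0 : 0 < l2norm v by rewrite lt_neqAle eq_sym vN0 l2norm_ge0.
have sv0 : 0 < sqn v by rewrite -l2norm_sqr exprn_gt0.
pose a := t%:R * e * (1 + e) / 2.
(* Negative, as large norms are at stake; it makes the base of the Laplace transform
   [(1 + e)^-1]. *)
pose kap := - (t%:R * e / ((1 + e) * 2 * sqn v)).
have e10 : 0 < 1 + e by lra.
have kapE : kap = - (a / ((1 + e) ^+ 2 * sqn v)).
  by rewrite /kap /a; field; rewrite !gt_eqF.
have DE : 1 + 2 * kap * sqn v / t%:R = (1 + e)^-1.
  by rewrite /kap; field; rewrite !gt_eqF.
pose c := ((1 + e) * l2norm v) `^ z * expR (- a).
have c0 : 0 <= c by rewrite mulr_ge0 ?powR_ge0 ?expR_ge0.
have pos : 0 < 1 + 2 * kap * sqn v / t%:R by rewrite DE invr_gt0.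
apply: (@le_trans _ _ (\int[P]_w (c%:E * (expR (- (kap * sqn (random_map G w v))))%:E))%E).
  apply: ge0_le_integral => //.
  - apply/measurable_EFinP; apply: measurable_maxr => //.
    apply: measurable_funB => //.
    exact: (measurableT_comp (@measurable_powR R z) (measurable_l2norm_random_map v)).
  - by apply: measurable_funeM; exact: measurable_expR_sqn.
  move=> w _; rewrite -EFinM lee_fin ge_max mulr_ge0 ?expR_ge0 //=.
  have [small|large] := leP (l2norm (random_map G w v)) ((1 + e) * l2norm v).
    apply: (@le_trans _ _ 0); last by rewrite mulr_ge0 ?expR_ge0.
    by rewrite subr_le0 powR_le ?l2norm_ge0 // ltW.
  pose q := l2norm (random_map G w v) / ((1 + e) * l2norm v).
  have el0 : 0 < (1 + e) * l2norm v by rewrite mulr_gt0.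
  have q1 : 1 <= q by rewrite ler_pdivlMr // mul1r ltW.
  have q0 : 0 <= q by lra.
  apply: (@le_trans _ _ (l2norm (random_map G w v) `^ z)).
    by rewrite lerBlDr lerDl powR_ge0.
  have -> : l2norm (random_map G w v) = (1 + e) * l2norm v * q.
    by rewrite /q mulrCA divff ?mulr1 // gt_eqF.
  rewrite powRM ?(ltW el0) // /c -mulrA ler_wpM2l ?powR_ge0 // -expRD.
  have -> : - a + - (kap * sqn (random_map G w v)) = a * (q ^+ 2 - 1).
    rewrite -(l2norm_sqr (random_map _ _ _)) kapE /q -(l2norm_sqr v).
    by field; rewrite !gt_eqF.
  apply: (@le_trans _ _ (expR (q - 1) `^ z)).
    apply: powR_le; rewrite ?(ltW z0) //.
    by have := expR_ge1Dx (q - 1); rewrite addrC subrK.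
  rewrite -expRM ler_expR.
  have za : z <= a * 2.
    apply: le_trans zt _; rewrite /a divfK // ler_peMr ?mulr_ge0 ?(ltW tR0) ?(ltW e0) //.
    by lra.
  have q10 : 0 <= q - 1 by lra.
  have a0 : 0 <= a by lra.
  have : (q - 1) * z <= (q - 1) * (a * 2) by rewrite ler_wpM2l.
  have : 0 <= a * (q - 1) ^+ 2 by rewrite mulr_ge0 ?sqr_ge0.
  by rewrite sqrrB; lra.
rewrite ge0_integralZl //; last first.
- exact: measurable_expR_sqn.
rewrite (laplace_sqn_random_map iidG t0 pos) -EFinM lee_fin DE /c -[leLHS]mulrA.
rewrite ler_wpM2l ?powR_ge0 //.
apply: (@le_trans _ _ (expR (- a) * expR (t%:R * e / 2))).
  rewrite ler_wpM2l ?expR_ge0 //; apply: inv_sqrt_exp_le; first by rewrite invr_gt0.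
  by rewrite invrK expR_ge1Dx.
by rewrite -expRD ler_expR /a; lra.
Qed.

(** On this event the exponential equals 1 for every [kap], while its mean tends to 0 as [kap]
    grows; [kap] is chosen to push the bound below [del]. *)
Lemma prob_random_map_eq0 (v : 'cV[R]_n) : v != 0 ->
  P [set w | sqn (random_map G w v) = 0] = 0%E.
Proof.
move=> vN0.
have v0 : 0 < sqn v.
  by rewrite lt_neqAle sqn_ge0 andbT eq_sym; apply: contra_neq vN0; exact: sqn_eq0.
have mA : measurable [set w | sqn (random_map G w v) = 0].
  rewrite (_ : [set _ | _] = (fun w => sqn (random_map G w v)) @^-1` [set 0]) //.
  by rewrite -[X in measurable X]setTI; exact: measurable_sqn_random_map.
apply/eqP; rewrite eq_le measure_ge0 andbT; apply/lee_addgt0Pr => del del0.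
rewrite add0e.
pose kap := del ^- 2 * t%:R / (2 * sqn v).
have DE : 1 + 2 * kap * sqn v / t%:R = 1 + del ^- 2.
  by rewrite /kap; field; rewrite !gt_eqF.
have D1 : 1 <= 1 + del ^- 2 by rewrite lerDl invr_ge0 sqr_ge0.
have D0 : 0 < 1 + del ^- 2 by apply: lt_le_trans D1.
apply: le_trans (@prob_le_laplace _ v 1 kap mA ler01 _ _) _.
- by rewrite DE.
- by move=> w /= ->; rewrite mulr0 oppr0 expR0 mulr1.
rewrite lee_fin mul1r DE.
have s1 : 1 <= Num.sqrt (1 + del ^- 2) by rewrite -[leLHS]sqrtr1 ler_wsqrtr.
have s0 : 0 < Num.sqrt (1 + del ^- 2) by rewrite sqrtr_gt0.
apply: (@le_trans _ _ (Num.sqrt (1 + del ^- 2))^-1).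
  rewrite -[leRHS]expr1; apply: ler_wiXn2l => //.
  - by rewrite invf_le1.
rewrite -[leRHS]invrK lef_pV2 ?posrE ?invr_gt0 //.
rewrite -[leLHS](@ger0_norm _ del^-1) ?invr_ge0 ?(ltW del0) // -sqrtr_sqr.
by rewrite ler_wsqrtr // exprVn lerDr.
Qed.

End Tails.

(** * Costs of assignments *)

Lemma powR_le_inv (R : realType) (a b z : R) : 0 < z -> 0 <= a -> 0 <= b ->
  a `^ z <= b `^ z -> a <= b.
Proof.
move=> z0 a0 b0; rewrite !leNgt; apply: contra => ba.
by apply: gt0_ltr_powR; rewrite ?nnegrE.
Qed.

Lemma fsubset_card_between (K : choiceType) (A B : {fset K}) k :
  (#|` A| <= k)%N -> (k <= #|` B|)%N ->
  exists C : {fset K}, (A `<=` C)%fset /\ #|` C| = k.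
Proof.
move=> Ak kB; move: {2}(k - #|` A|)%N (erefl (k - #|` A|)%N) => m.
elim: m A Ak => [|m IH] A Ak mE.
  by exists A; split => //; apply/eqP; rewrite eqn_leq Ak -subn_eq0 mE.
have [sBA|/fsubsetPn[b bB bA]] := boolP (B `<=` A)%fset.
  move: mE; rewrite (eqP (_ : (k - #|` A| == 0)%N)) // subn_eq0.
  by rewrite (leq_trans kB) // fsubset_leq_card.
have cA : #|` b |` A|%fset = #|` A|.+1 by rewrite cardfsU1 bA.
have [||C [AC Ck]] := IH (b |` A)%fset; rewrite ?cA.
- by rewrite ltnNge -subn_eq0 mE.
- by rewrite subnS mE.
by exists C; split => //; apply: fsubset_trans AC; exact: fsubsetU1.
Qed.

Section AssignCost.
Context {R : realType} {m : nat} {I : finType}.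
Variables (z : R) (chi : I -> R) (p : I -> 'cV[R]_m).

(** This is a [z]-th power of a cost in which the assignment is frozen and centers may coincide.
    Unlike [cost] it has no infimum and no cardinality constraint, and it is continuous in the
    centers. *)
Definition assign_cost (k : nat) (c : 'I_k -> 'cV[R]_m) (tau : {ffun I -> 'I_k}) : R :=
  \sum_i chi i * l2norm (p i - c (tau i)) `^ z.

(* [chi] picks one index for each element of [Y]; an indexing of the image of a point
   set may repeat elements, since the random map need not be injective. *)
Definition selects (Y : {fset 'cV[R]_m}) : Prop :=
  forall F : 'cV[R]_m -> R, \sum_(y <- Y) F y = \sum_i chi i * F (p i).

Hypothesis (z0 : 0 < z) (chi0 : forall i, 0 <= chi i).

Lemma inf_dist_le (C : {fset 'cV[R]_m}) (y c : 'cV[R]_m) : c \in C ->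
  inf [set l2norm (y - c) `^ z | c in [set` C]] <= l2norm (y - c) `^ z.
Proof.
move=> cC; apply: ge_inf; last by exists c.
by exists 0 => _ [? _ <-]; exact: powR_ge0.
Qed.

Lemma inf_dist_ge0 (C : {fset 'cV[R]_m}) (y : 'cV[R]_m) :
  0 <= inf [set l2norm (y - c) `^ z | c in [set` C]].
Proof.
set A := [set _ | _ in _]; have [ne|/nonemptyPn ->] := pselect (A !=set0).
  by apply: lb_le_inf => // _ [? _ <-]; exact: powR_ge0.
by rewrite inf0.
Qed.

Variables (Y : {fset 'cV[R]_m}) (k : nat).
Hypothesis selY : selects Y.

Lemma cost_ge0 C : 0 <= cost z Y C.
Proof. exact: powR_ge0. Qed.

Lemma cost_powR C :
  cost z Y C `^ z = \sum_i chi i * inf [set l2norm (p i - c) `^ z | c in [set` C]].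
Proof.
rewrite /cost -powRrM mulVf ?gt_eqF // powRr1 ?selY //.
by rewrite sumr_ge0 // => i _; rewrite mulr_ge0 ?inf_dist_ge0.
Qed.

Lemma cost_assignment C : #|` C| = k -> (0 < k)%N ->
  exists c tau, assign_cost (c : 'I_k -> _) tau = cost z Y C `^ z.
Proof.
move=> Ck k0; pose c (j : 'I_k) := nth 0 C j.
have jC : forall j, c j \in C by move=> j; rewrite mem_nth // Ck.
exists c.
have nearest i : exists j, forall j', l2norm (p i - c j) `^ z <= l2norm (p i - c j') `^ z.
  have [j _ jmin] := @Order.TotalTheory.arg_minP _ R _ (Ordinal k0) xpredT
    (fun j => l2norm (p i - c j) `^ z) isT.
  by exists j => j'; exact: jmin.
have [tau tauP] := choice nearest.
exists [ffun i => tau i]; rewrite cost_powR; apply: eq_bigr => i _; congr (_ * _).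
rewrite ffunE; apply/eqP; rewrite eq_le inf_dist_le // andbT.
apply: lb_le_inf.
  by exists (l2norm (p i - c (Ordinal k0)) `^ z); exists (c (Ordinal k0)) => //=; exact: jC.
move=> _ [c' c'C <-]; have c'k : (index c' C < k)%N by rewrite -Ck index_mem.
have -> : c' = c (Ordinal c'k) by rewrite /c /= nth_index.
exact: tauP.
Qed.

(* [C0] only serves to pad the set of centers to exactly [k] elements. *)
Lemma cost_le_assign (C0 : {fset 'cV[R]_m}) (c : 'I_k -> 'cV[R]_m) tau : #|` C0| = k ->
  exists C : {fset 'cV[R]_m}, #|` C| = k /\ cost z Y C `^ z <= assign_cost c tau.
Proof.
move=> C0k; pose A := seq_fset tt [seq c j | j <- enum 'I_k].
have Ak : (#|` A| <= k)%N.
  by rewrite size_seq_fset (leq_trans (size_undup _)) // size_map size_enum_ord.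
have [|C [AC Ck]] := @fsubset_card_between _ A C0 k Ak; first by rewrite C0k.
exists C; split => //; rewrite cost_powR; apply: ler_sum => i _.
rewrite ler_wpM2l // inf_dist_le //; apply: (fsubsetP AC).
by rewrite seq_fsetE map_f // mem_enum.
Qed.

End AssignCost.

(** * Continuity in the centers and existence of optimal ones *)

Import numFieldNormedType.Exports.

(** The absolute value avoids the default values of the power at negative bases. Away from 0 the
    power is differentiable; at 0 the radius [eps ^ (1 / z)] works. *)
Lemma continuous_norm_powR (R : realType) (z : R) : 0 < z ->
  continuous (fun x : R => `|x| `^ z).
Proof.
move=> z0 x; have [->|x0] := eqVneq x 0.
  apply/cvgrPdist_lt => /= eps eps0; near=> y.
  rewrite normr0 powR0 ?gt_eqF // sub0r normrN ger0_norm ?powR_ge0 //.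
  rewrite [ltRHS](_ : eps = (eps `^ z^-1) `^ z); last first.
    by rewrite -powRrM mulVf ?gt_eqF // powRr1 // ltW.
  apply: gt0_ltr_powR; rewrite ?nnegrE ?powR_ge0 //.
  near: y; have : 0 < eps `^ z^-1 by rewrite powR_gt0.
  move=> e0; have := @nbhsx_ballx _ R 0 _ e0; apply: filterS => y.
  by rewrite /ball /= sub0r normrN.
apply: (@continuous_comp _ _ _ (fun x : R => `|x|) (fun x : R => x `^ z)).
  exact: norm_continuous.
apply: differentiable_continuous; apply/derivable1_diffP.
by apply: derivable_powR; rewrite in_itv /= andbT normr_gt0.
Unshelve. all: by end_near. Qed.

Lemma continuous_finite_sum (R : realType) (S : topologicalType) (J : Type)
    (r : seq J) (F : J -> S -> R) :
  (forall j, continuous (F j)) -> continuous (fun x => \sum_(j <- r) F j x).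
Proof.
move=> cF x; elim: r => [|j r IH].
  by under eq_fun do rewrite big_nil; exact: cvg_cst.
under eq_fun do rewrite big_cons.
by apply: cvgD; [exact: cF|exact: IH].
Qed.

Section CenterSpace.
Context {R : realType} {m k : nat} {I : finType}.
Variables (z : R) (chi : I -> R) (p : I -> 'cV[R]_m).
Hypotheses (z0 : 0 < z) (chi0 : forall i, 0 <= chi i).

(** Flattening all centers into one row gives access to compactness of boxes and to the countable
    set of rational rows. *)
Definition centers_of (K : Type) (f : 'rV[K]_(k * m)) (j : 'I_k) : 'cV[K]_m :=
  \col_l f ord0 (mxvec_index j l).

Lemma centers_of_surj (c : 'I_k -> 'cV[R]_m) : exists f, centers_of f = c.
Proof.
exists (mxvec (\matrix_(j, l) c j l ord0)); apply/funext => j.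
by apply/matrixP => l o; rewrite mxE mxvecE mxE (ord1 o).
Qed.

Lemma continuous_assign_cost tau :
  continuous (fun f => assign_cost z chi p (centers_of f) tau).
Proof.
apply: continuous_finite_sum => i f.
have cz : continuous_at f (fun f => l2norm (p i - centers_of f (tau i)) `^ z).
  suff : continuous_at f (fun f => `|l2norm (p i - centers_of f (tau i))| `^ z).
    by under eq_fun do rewrite ger0_norm ?l2norm_ge0 //.
  apply: (@continuous_comp _ _ _ (fun f => l2norm (p i - centers_of f (tau i)))
    (fun x : R => `|x| `^ z)); last exact: continuous_norm_powR.
  apply: (@continuous_comp _ _ _ (fun f => sqn (p i - centers_of f (tau i)))
    (@Num.sqrt R)); last exact: sqrt_continuous.
  apply: continuous_finite_sum => l {}f.
  have c1 : continuous_at f (fun g => (p i - centers_of g (tau i)) l ord0).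
    under eq_fun do rewrite !mxE.
    by apply: continuousB; [exact: cst_continuous|exact: coord_continuous].
  exact: (cvgM c1 c1).
exact: (cvgM (cvg_cst _) cz).
Qed.

Lemma assign_cost_rat tau c b : assign_cost z chi p c tau < b ->
  exists q : 'rV[rat]_(k * m), assign_cost z chi p (centers_of (map_mx ratr q)) tau < b.
Proof.
have [f <-] := centers_of_surj c => fb.
have : \forall g \near f, assign_cost z chi p (centers_of g) tau < b.
  have := @continuous_assign_cost tau f.
  by move=> /cvgr_lt; apply.
move=> /nbhs_ballP[e /= e0 He].
have H j : exists q : rat, ball (f ord0 j) e (ratr q : R).
  have [|q] := @rat_in_itvoo R (f ord0 j - e) (f ord0 j + e); first by lra.
  by rewrite in_itv /= => H; exists q; rewrite /ball /= ltr_distlC.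
have [q Hq] := choice H.
exists (\row_j q j); apply: He; split => // o j.
by rewrite !mxE (ord1 o).
Qed.

Lemma assign_cost_min_fixed tau : exists c : 'I_k -> 'cV[R]_m,
  forall c' : 'I_k -> 'cV[R]_m,
  assign_cost z chi p c tau <= assign_cost z chi p c' tau.
Proof.
pose B : R := \sum_i \sum_l `|p i l ord0|.
have B0 : 0 <= B by apply: sumr_ge0 => i _; apply: sumr_ge0.
have pB i l : `|p i l ord0| <= B.
  rewrite /B (bigD1 i) //= (bigD1 l) //= -addrA lerDl addr_ge0 ?sumr_ge0 // => j _.
  exact: sumr_ge0.
pose box := [set f : 'rV[R]_(k * m) | forall j, `[- B, B]%classic (f ord0 j)].
have box_compact : compact box.
  exact: (@rV_compact R _ (fun=> `[- B, B]%classic) (fun=> @segment_compact R (- B) B)).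
have [||f fbox fmin] := @compact_EVT_min _ R
    (fun f => assign_cost z chi p (centers_of f) tau) box _ box_compact.
- by exists 0 => j /=; rewrite mxE in_itv /= B0 oppr_le0 B0.
- by apply: continuous_subspaceT => f; exact: (@continuous_assign_cost tau f).
exists (centers_of f) => c'; have [g <-] := centers_of_surj c'.
(* Clamping all coordinates to the box containing the points does not increase distances. *)
pose clamp x : R := Num.max (- B) (Num.min B x).
apply: le_trans (fmin (map_mx clamp g) _) _.
  rewrite inE => j /=; rewrite mxE in_itv /= /clamp le_max lexx /= ge_max ge_min lexx /=.
  by rewrite andbT; lra.
apply: ler_sum => i _; apply: ler_wpM2l; first exact: chi0.
apply: powR_le; [exact: ltW|exact: l2norm_ge0|].
rewrite !l2normE ler_wsqrtr //; apply: ler_sum => l _.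
rewrite !mxE -!expr2; set x := g _ _; set y := p i l ord0.
have := pB i l; rewrite -/y ler_norml => /andP[y1 y2].
rewrite -(real_normK (num_real (y - clamp x))) -(real_normK (num_real (y - x))).
rewrite ler_pXn2r ?nnegrE ?normr_ge0 // /clamp.
case: (leP B x) => Bx; [case: (leP (- B) B) => ?|case: (leP (- B) x) => ?].
- by rewrite !ler0_norm; lra.
- by lra.
- by [].
- by rewrite !ger0_norm; lra.
Qed.

Lemma assign_cost_min : (0 < k)%N ->
  exists (c : 'I_k -> 'cV[R]_m) tau, forall (c' : 'I_k -> 'cV[R]_m) tau',
  assign_cost z chi p c tau <= assign_cost z chi p c' tau'.
Proof.
move=> k0; have [c Hc] := choice assign_cost_min_fixed.
pose tau0 : {ffun I -> 'I_k} := [ffun=> Ordinal k0].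
have [tau _ Htau] := @Order.TotalTheory.arg_minP _ R _ tau0 xpredT
  (fun tau => assign_cost z chi p (c tau) tau) isT.
exists (c tau), tau => c' tau'; apply: le_trans (Hc tau' c').
exact: Htau.
Qed.

End CenterSpace.

Section FirstOccurrence.
Context {R : realType} {m N : nat}.
Variable p : 'I_N -> 'cV[R]_m.

(** Choosing the least index with a given value involves finitely many comparisons of points, so the
    choice is measurable for random points. *)
Definition first_occurrence (i : 'I_N) : bool := [forall j : 'I_N, (j < i)%N ==> (p j != p i)].

Lemma selects_first_occurrence (Y : {fset 'cV[R]_m}) :
  (forall y, (y \in Y) = [exists i, p i == y]) ->
  selects (fun i => (first_occurrence i)%:R) p Y.
Proof.
move=> memY F.
under [RHS]eq_bigr do rewrite mulr_natl mulrb.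
rewrite -big_mkcond /= -[RHS]big_filter.
transitivity (\sum_(y <- [seq p i | i <- index_enum 'I_N & first_occurrence i]) F y);
  last by rewrite big_map.
apply: perm_big; apply: uniq_perm.
- exact: fset_uniq.
- rewrite map_inj_in_uniq ?filter_uniq ?index_enum_uniq // => i j.
  rewrite !mem_filter => /andP[/forallP fi _] /andP[/forallP fj _] pij.
  apply/val_inj; case: (ltngtP i j) => // ij.
  + by have := fj i; rewrite ij pij eqxx.
  + by have := fi j; rewrite ij pij eqxx.
move=> y; rewrite memY; apply/existsP/mapP => [[i /eqP piy]|[i _ ->]]; last by exists i.
case: (@arg_minnP _ i (fun i => p i == y) val); first exact/eqP.
move=> j /eqP pjy jmin; exists j => //.
rewrite mem_filter mem_index_enum andbT; apply/forallP => l; apply/implyP => lj.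
by apply/negP => /eqP plj; have := jmin l; rewrite plj pjy eqxx leqNgt lj => /(_ isT).
Qed.

Lemma first_occurrence_inj : injective p -> forall i, first_occurrence i.
Proof.
move=> pI i; apply/forallP => j; apply/implyP => ji; apply/eqP => /pI e.
by rewrite e ltnn in ji.
Qed.

End FirstOccurrence.

(** * Measurability *)

(** The set pads families with repeated centers to [k] distinct ones; in dimension 0 there is only
    one point. *)
Lemma exists_fset_card (R : realType) (t k : nat) : (0 < t)%N ->
  exists C : {fset 'cV[R]_t}, #|` C| = k.
Proof.
move=> t0; exists (seq_fset tt [seq const_mx i%:R | i <- iota 0 k]).
rewrite size_seq_fset undup_id ?size_map ?size_iota // map_inj_uniq ?iota_uniq //.
move=> i j /matrixP/(_ (Ordinal t0) ord0); rewrite !mxE => /eqP.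
by rewrite eqr_nat => /eqP.
Qed.

Section OptimalCost.
Context {R : realType} {m k : nat} {I : finType}.
Variables (z : R) (chi : I -> R) (p : I -> 'cV[R]_m) (Y C0 : {fset 'cV[R]_m}).
Hypotheses (z0 : 0 < z) (chi0 : forall i, 0 <= chi i) (k0 : (0 < k)%N).
Hypotheses (C0k : #|` C0| = k) (selY : selects chi p Y).

Lemma optimal_clustering_exists : exists C, optimal_clustering k z Y C.
Proof.
have [c [tau H]] := assign_cost_min p z0 chi0 k0.
have [C [Ck Cle]] := cost_le_assign z0 chi0 selY c tau C0k.
exists C; split; first exact: Ck.
move=> C' C'k.
have [c' [tau' E]] := cost_assignment z0 chi0 selY C'k k0.
apply: (powR_le_inv z0); [exact: cost_ge0|exact: cost_ge0|].
by apply: le_trans Cle _; rewrite -E; exact: H.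
Qed.

Lemma optimal_clustering_le C c tau : optimal_clustering k z Y C ->
  cost z Y C `^ z <= assign_cost z chi p (c : 'I_k -> _) tau.
Proof.
move=> [Ck opt]; have [C' [C'k C'le]] := cost_le_assign z0 chi0 selY c tau C0k.
apply: le_trans C'le; apply: powR_le; [exact: ltW|exact: cost_ge0|exact: opt].
Qed.

(** Passing to [z]-th powers replaces the optimal set by one quantifier of each kind over centers
    and assignments, a form that countable operations can express. *)
Lemma optimal_cost_between (a b : R) : 0 <= a -> 0 <= b ->
  (exists C, [/\ optimal_clustering k z Y C, a <= cost z Y C & cost z Y C <= b]) <->
  (exists c tau, assign_cost z chi p (c : 'I_k -> _) tau <= b `^ z) /\
  (forall c tau, a `^ z <= assign_cost z chi p (c : 'I_k -> _) tau).
Proof.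
move=> a0 b0; split=> [[C [opt aC Cb]]|[[c [tau cb]] Ha]].
  have [c [tau E]] := cost_assignment z0 chi0 selY opt.1 k0.
  split=> [|c' tau'].
    by exists c, tau; rewrite E; apply: powR_le; [exact: ltW|exact: cost_ge0|].
  apply: le_trans (optimal_clustering_le c' tau' opt).
  by apply: powR_le; [exact: ltW| |].
have [C opt] := optimal_clustering_exists; exists C; split; first exact: opt.
  have [c' [tau' E]] := cost_assignment z0 chi0 selY opt.1 k0.
  by apply: (powR_le_inv z0); [|exact: cost_ge0|rewrite -E; exact: Ha].
apply: (powR_le_inv z0); [exact: cost_ge0| |] => //.
exact: le_trans (optimal_clustering_le c tau opt) cb.
Qed.

End OptimalCost.

Section RandomImage.
Context {R : realType} {d : measure_display} {T : measurableType d}.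
Variables (P : probability T R) (t n : nat) (G : 'I_t -> 'I_n -> {RV P >-> R}).
Variable X : {fset 'cV[R]_n}.

Definition fset_point (i : 'I_(#|` X|)) : 'cV[R]_n := nth 0 X i.
Definition image_point (w : T) (i : 'I_(#|` X|)) : 'cV[R]_t :=
  random_map G w (fset_point i).
Definition image_set (w : T) : {fset 'cV[R]_t} := [fset random_map G w x | x in X]%fset.
Definition image_weight (w : T) (i : 'I_(#|` X|)) : R :=
  (first_occurrence (image_point w) i)%:R.

Lemma fset_pointP x : x \in X -> exists i, fset_point i = x.
Proof.
rewrite -index_mem => xX; exists (Ordinal xX); rewrite /fset_point /=.
by rewrite nth_index // -index_mem.
Qed.

Lemma selects_fset_point : selects (fun=> 1) fset_point X.
Proof.
move=> F; rewrite (big_nth 0) big_mkord; apply: eq_bigr => i _.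
by rewrite mul1r.
Qed.

Lemma selects_image_set w : selects (image_weight w) (image_point w) (image_set w).
Proof.
apply: selects_first_occurrence => y; apply/imfsetP/existsP => [[x /= xX ->]|[i /eqP <-]].
  by have [i <-] := fset_pointP xX; exists i.
by exists (fset_point i) => //=; rewrite mem_nth.
Qed.

Lemma fset_point_inj : injective fset_point.
Proof.
move=> i j /eqP; rewrite nth_uniq ?fset_uniq // => /eqP; exact: val_inj.
Qed.

Lemma measurable_eq0_sqn v : measurable [set w | sqn (random_map G w v) = 0].
Proof.
rewrite (_ : [set _ | _] = setT `&` (fun w => sqn (random_map G w v)) @^-1` [set 0]).
  by apply: measurable_sqn_random_map => //; exact: measurable_set1.
by rewrite setTI.
Qed.

(** By linearity, two images coincide exactly when the image of a fixed difference vanishes; the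
    weight is the indicator of a finite intersection of complements of such events. *)
Lemma measurable_image_weight i : measurable_fun setT (fun w => image_weight w i).
Proof.
pose A := \bigcap_(j in [set` [pred j : 'I_(#|` X|) | (j < i)%N]])
  ~` [set w | sqn (random_map G w (fset_point j - fset_point i)) = 0].
have -> : (fun w => image_weight w i) = \1_A.
  apply/funext => w; rewrite indicE /image_weight; congr (nat_of_bool _)%:R.
  apply/forallP/idP => [H|/set_mem H j].
    apply/mem_set => j ji /= e; have /implyP/(_ ji)/eqP := H j; apply.
    apply/eqP; rewrite -subr_eq0 /image_point -random_mapB; apply/eqP.
    exact: sqn_eq0.
  apply/implyP => ji; apply/eqP => e; apply: (H j ji) => /=.
  by rewrite random_mapB -/(image_point w j) e subrr sqn0.
apply: measurable_indic; apply: fin_bigcap_measurable => // j _.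
by apply: measurableC; exact: measurable_eq0_sqn.
Qed.

Lemma measurable_assign_cost (k : nat) z (c : 'I_k -> 'cV[R]_t) tau :
  measurable_fun setT (fun w => assign_cost z (image_weight w) (image_point w) c tau).
Proof.
apply: measurable_sum => i; apply: measurable_funM; first exact: measurable_image_weight.
apply: (measurableT_comp (@measurable_powR R z)).
apply: (@measurableT_comp _ _ _ _ _ _ (@Num.sqrt R)).
  by apply: continuous_measurable_fun; exact: sqrt_continuous.
exact: measurable_sqn_random_mapB.
Qed.

Lemma measurable_optimal_cost_between (k : nat) (z a b : R) :
  0 < z -> (0 < k)%N -> (0 < t)%N -> 0 <= a -> 0 <= b ->
  measurable [set w | exists C, [/\ optimal_clustering k z (image_set w) C,
    a <= cost z (image_set w) C & cost z (image_set w) C <= b]].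
Proof.
move=> z0 k0 t0 a0 b0; have [C0 C0k] := exists_fset_card R k t0.
have w0 w i : 0 <= image_weight w i by rewrite ler0n.
pose AC (w : T) c tau : R :=
  assign_cost z (image_weight w) (image_point w) (c : 'I_k -> 'cV[R]_t) tau.
pose ratc (q : 'rV[rat]_(k * t)) := centers_of (map_mx (@ratr R) q).
pose lo := \bigcap_(qt in [set: 'rV[rat]_(k * t) * {ffun 'I_(#|` X|) -> 'I_k}])
  [set w | a `^ z <= AC w (ratc qt.1) qt.2].
pose hi := \bigcap_(N in [set: nat])
  \bigcup_(qt in [set: 'rV[rat]_(k * t) * {ffun 'I_(#|` X|) -> 'I_k}])
  [set w | AC w (ratc qt.1) qt.2 < b `^ z + N.+1%:R^-1].
rewrite (_ : [set _ | _] = lo `&` hi); last first.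
  apply/seteqP; split => w /=.
    move=> /(optimal_cost_between z0 (w0 w) k0 C0k (selects_image_set w) a0 b0).
    move=> [[c [tau cb]] Ha]; split=> [qt _|N _]; first exact: Ha.
    have [|q Hq] := @assign_cost_rat R t k _ z (image_weight w) (image_point w) z0 tau c
       (b `^ z + N.+1%:R^-1).
      by rewrite (le_lt_trans cb) // ltrDl invr_gt0.
    by exists (q, tau).
  move=> [Hlo Hhi].
  apply/(optimal_cost_between z0 (w0 w) k0 C0k (selects_image_set w) a0 b0); split.
    (* The infimum is attained, so staying below [b ^ z + 1 / (N + 1)] for every [N] produces one
       choice of centers below [b ^ z]. *)
    have [c [tau H]] := assign_cost_min (image_point w) z0 (w0 w) k0.
    exists c, tau; apply/ler_addgt0Pr => e e0.
    pose N := Num.bound e^-1.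
    have [[q tau'] _ /= Hq] := Hhi N I.
    apply: le_trans (H (ratc q) tau') _; apply: le_trans (ltW Hq) _.
    rewrite lerD2l -[leRHS]invrK lef_pV2 ?posrE ?invr_gt0 ?ltr0n //.
    apply: le_trans (ltW (archi_boundP _)) _; first by rewrite invr_ge0 ltW.
    by rewrite ler_nat.
  (* A strict violation is an open condition, so some rational centers violate the bound too. *)
  move=> c tau; rewrite leNgt; apply/negP => clt.
  have [q Hq] := assign_cost_rat z0 clt.
  by have := Hlo (q, tau) I; rewrite /= leNgt /AC Hq.
apply: measurableI.
  rewrite -[lo]setCK setC_bigcap; apply: measurableC.
  apply: countable_bigcupT_measurable => // qt; apply: measurableC.
  apply: measurable_set_bool; apply: measurable_fun_ler => //.
  exact: measurable_assign_cost.
apply: bigcapT_measurable => N; apply: countable_bigcupT_measurable => // qt.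
apply: measurable_set_bool; apply: measurable_fun_ltr => //.
exact: measurable_assign_cost.
Qed.

End RandomImage.

(** * The failure probability *)

Section MeanBound.
Context {R : realType} {d : measure_display} {T : measurableType d}.
Variable P : probability T R.
Implicit Types (f g : T -> R) (b : R).

(** Bundling measurability and nonnegativity with the bound lets mean estimates be added, scaled and
    summed without repeating side conditions. *)
Definition mean_le f b : Prop :=
  [/\ measurable_fun setT f, (forall w, 0 <= f w) & (\int[P]_w (f w)%:E <= b%:E)%E].

Lemma mean_le_add f g b b' : mean_le f b -> mean_le g b' ->
  mean_le (fun w => f w + g w) (b + b').
Proof.
move=> [mf f0 fb] [mg g0 gb]; split.
- exact: measurable_funD.
- by move=> w; rewrite addr_ge0.
under eq_integral do rewrite EFinD.
rewrite ge0_integralD //; first by rewrite EFinD leeD.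
all: by [exact/measurable_EFinP | move=> w _; rewrite lee_fin].
Qed.

Lemma mean_le_scale a f b : 0 <= a -> mean_le f b -> mean_le (fun w => a * f w) (a * b).
Proof.
move=> a0 [mf f0 fb]; split.
- exact: measurable_funM.
- by move=> w; rewrite mulr_ge0.
under eq_integral do rewrite EFinM.
rewrite ge0_integralZl //; first by rewrite EFinM lee_wpmul2l.
all: by [exact/measurable_EFinP | move=> w _; rewrite lee_fin].
Qed.

Lemma mean_le_sum (I : finType) (f : I -> T -> R) (b : I -> R) :
  (forall i, mean_le (f i) (b i)) ->
  mean_le (fun w => \sum_i f i w) (\sum_i b i).
Proof.
move=> H; elim: (index_enum I) => [|i r IH].
  under eq_fun do rewrite big_nil; rewrite big_nil; split => //.
  by rewrite integral0.
under eq_fun do rewrite big_cons; rewrite big_cons.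
exact: mean_le_add.
Qed.

Lemma mean_le_bool (c : T -> bool) b : measurable [set w | c w] ->
  (P [set w | c w] <= b%:E)%E -> mean_le (fun w => (c w)%:R) b.
Proof.
move=> mc cb; have E : (fun w => (c w)%:R) = \1_[set w | c w] :> (T -> R).
  by apply/funext => w; rewrite indicE mem_setE.
rewrite E; split => //.
by rewrite integral_indic // setIT.
Qed.

Lemma markov_mean_le f b : mean_le f b -> (P [set w | 1 <= f w]%R <= b%:E)%E.
Proof.
move=> [mf f0 fb]; have mA : measurable [set w | 1 <= f w].
  by apply: measurable_set_bool; exact: measurable_fun_ler.
apply: le_trans fb.
have -> : P [set w | 1 <= f w]%R = (\int[P]_w (\1_[set w | 1 <= f w] w)%:E)%E.
  by rewrite integral_indic // setIT.
apply: ge0_le_integral => //.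
- exact/measurable_EFinP.
- exact/measurable_EFinP.
move=> w _; rewrite lee_fin indicE.
by have [/set_mem|_] := boolP (w \in _).
Qed.

End MeanBound.

Section JointEvent.
Context {R : realType} {d : measure_display} {T : measurableType d}.
Variables (P : probability T R) (t n : nat) (G : 'I_t -> 'I_n -> {RV P >-> R}).
Hypothesis (iidG : iid_gaussian_entries G) (t0 : (0 < t)%N).
Context {I K : finType}.
Variables (x : I -> 'cV[R]_n) (c : K -> 'cV[R]_n) (sg : I -> K) (z e th th1 : R).
Hypothesis (e0 : 0 < e) (e1 : e <= 1) (z1 : 1 <= z) (zte : z <= t%:R * e).
Hypotheses (th0 : 0 < th) (th10 : 0 < th1).

Let fx w i := random_map G w (x i).
Let fc w k := random_map G w (c k).
Let contractedw w := contracted x c (fx w) (fc w) e.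
Let O := total_cost x c sg z.
Let del : R := expR (- (t%:R * e ^+ 2 / 8)).

Hypothesis O0 : 0 < O.

(** Each summand is normalized to reach 1 whenever one requirement of the deterministic part fails,
    so a single use of Markov's inequality covers all of them. *)
Definition defect (w : T) : R :=
  \sum_k \sum_k' (contractedw w (inr k) (inr k'))%:R
  + (th * th1 * O ^+ 2)^-1 *
    \sum_i opt_dist x c sg i `^ z * contracted_mass x c (fx w) (fc w) sg z e (inl i)
  + (th * O)^-1 * \sum_k contracted_mass x c (fx w) (fc w) sg z e (inr k)
  + (th1 * O)^-1 * \sum_i excess x c (fx w) (fc w) sg z e i.

Lemma mean_le_contracted u v : mean_le P (fun w => (contractedw w u v)%:R) del.
Proof.
have E w : contractedw w u v = ((1 + e) ^+ 2 * sqn (random_map G w (pts x c u - pts x c v))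
    < sqn (pts x c u - pts x c v)).
  rewrite /contractedw /contracted /noncontracted -ltNge -scalerBr sqnZ random_mapB.
  by case: u v => [i|k] [j|k'].
apply: mean_le_bool.
  apply: measurable_set_bool; under eq_fun do rewrite E.
  apply: measurable_fun_ltr => //; apply: measurable_funM => //.
  exact: measurable_sqn_random_map.
under eq_set do rewrite E.
exact: prob_contract_le.
Qed.

Lemma mean_le_excess i : mean_le P (fun w => excess x c (fx w) (fc w) sg z e i)
  (((1 + e) * opt_dist x c sg i) `^ z * del).
Proof.
have E w : excess x c (fx w) (fc w) sg z e i =
    Num.max 0 (l2norm (random_map G w (x i - c (sg i))) `^ z
               - ((1 + e) * l2norm (x i - c (sg i))) `^ z).
  by rewrite /excess /image_dist /fx /fc -random_mapB.
split.
- under eq_fun do rewrite E; apply: measurable_maxr => //; apply: measurable_funB => //.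
  apply: (measurableT_comp (@measurable_powR R z)).
  exact: measurable_l2norm_random_map.
- by move=> w; rewrite le_max lexx.
under eq_integral do rewrite E.
apply: le_trans (integral_excess_le iidG t0 _ e0 e1 z1 zte) _.
rewrite lee_fin ler_wpM2l ?powR_ge0 // ler_expR lerN2.
have : 0 <= t%:R * e ^+ 2 by rewrite mulr_ge0 ?sqr_ge0.
by lra.
Qed.

Lemma mean_le_contracted_mass u :
  mean_le P (fun w => contracted_mass x c (fx w) (fc w) sg z e u) (O * del).
Proof.
rewrite /O /total_cost mulr_suml; apply: mean_le_sum => i.
by apply: mean_le_scale; [exact: powR_ge0|exact: mean_le_contracted].
Qed.

(** All powers of [total_cost] cancel against the normalizations: neither the points nor their
    number survives in the bound. *)
Lemma mean_le_defect : mean_le P defect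
  (del * (#|K|%:R ^+ 2 + (th * th1)^-1 + #|K|%:R / th + (1 + e) `^ z / th1)).
Proof.
have sumK (a : R) : \sum_(k : K) a = #|K|%:R * a by rewrite sumr_const mulr_natl.
have -> : del * (#|K|%:R ^+ 2 + (th * th1)^-1 + #|K|%:R / th + (1 + e) `^ z / th1) =
    \sum_(k : K) \sum_(k' : K) del
  + (th * th1 * O ^+ 2)^-1 * (\sum_i opt_dist x c sg i `^ z * (O * del))
  + (th * O)^-1 * (\sum_(k : K) O * del)
  + (th1 * O)^-1 * \sum_i ((1 + e) * opt_dist x c sg i) `^ z * del.
  rewrite !sumK -!mulr_suml -/(total_cost x c sg z) -/O.
  have -> : \sum_i ((1 + e) * opt_dist x c sg i) `^ z = (1 + e) `^ z * O.
    rewrite /O /total_cost mulr_sumr; apply: eq_bigr => i _.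
    by rewrite powRM ?opt_dist_ge0 // addr_ge0 // ltW.
  by field; rewrite !gt_eqF.
apply: mean_le_add; [apply: mean_le_add; [apply: mean_le_add|]|].
- by do 2 apply: mean_le_sum => ?; exact: mean_le_contracted.
- apply: mean_le_scale; first by rewrite invr_ge0 ltW // !mulr_gt0 // exprn_gt0.
  apply: mean_le_sum => i; apply: mean_le_scale; first exact: powR_ge0.
  exact: mean_le_contracted_mass.
- apply: mean_le_scale; first by rewrite invr_ge0 ltW // mulr_gt0.
  by apply: mean_le_sum => k; exact: mean_le_contracted_mass.
- apply: mean_le_scale; first by rewrite invr_ge0 ltW // mulr_gt0.
  by apply: mean_le_sum => i; exact: mean_le_excess.
Qed.

Lemma defect_lt1 w : defect w < 1 ->
  [/\ forall k k', ~~ contractedw w (inr k) (inr k'),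
    \sum_i opt_dist x c sg i `^ z * contracted_mass x c (fx w) (fc w) sg z e (inl i)
      <= th * th1 * O ^+ 2,
    \sum_k contracted_mass x c (fx w) (fc w) sg z e (inr k) <= th * O &
    \sum_i excess x c (fx w) (fc w) sg z e i <= th1 * O].
Proof.
rewrite /defect; set A := \sum_k \sum_k' _; set B := \sum_i _ `^ z * _.
set C := \sum_k _; set D := \sum_i excess _ _ _ _ _ _ _ _.
have A0 : 0 <= A by apply: sumr_ge0 => k _; apply: sumr_ge0 => k' _; rewrite ler0n.
have B0 : 0 <= B.
  by apply: sumr_ge0 => i _; apply: mulr_ge0; [exact: powR_ge0|exact: contracted_mass_ge0].
have C0 : 0 <= C by apply: sumr_ge0 => k _; exact: contracted_mass_ge0.
have D0 : 0 <= D by apply: sumr_ge0 => i _; rewrite /excess le_max lexx.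
have b0 : 0 < th * th1 * O ^+ 2 by rewrite !mulr_gt0 // exprn_gt0.
have c0 : 0 < th * O by rewrite mulr_gt0.
have d0 : 0 < th1 * O by rewrite mulr_gt0.
have B0' : 0 <= (th * th1 * O ^+ 2)^-1 * B by rewrite mulr_ge0 // invr_ge0 ltW.
have C0' : 0 <= (th * O)^-1 * C by rewrite mulr_ge0 // invr_ge0 ltW.
have D0' : 0 <= (th1 * O)^-1 * D by rewrite mulr_ge0 // invr_ge0 ltW.
move=> lt1; split.
- move=> k k'; apply/negP => kk'.
  have : A < 1 by lra.
  rewrite ltNge => /negP; apply; rewrite /A (bigD1 k) //= (bigD1 k') //= kk'.
  rewrite -addrA lerDl addr_ge0 ?sumr_ge0 // => i _.
  by rewrite sumr_ge0.
- by rewrite -[leRHS]mulr1 -ler_pdivrMl //; lra.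
- by rewrite -[leRHS]mulr1 -ler_pdivrMl //; lra.
- by rewrite -[leRHS]mulr1 -ler_pdivrMl //; lra.
Qed.

End JointEvent.

(** * Choice of the constants *)

Section Dimension.
Context {R : realType}.
Implicit Types (z eps e : R) (k t : nat).

Lemma ln2_ge_half : 1 / 2 <= ln (2 : R).
Proof.
have := @le_ln1Dx R (- (1 / 2)); have -> : 1 + - (1 / 2) = 2^-1 :> R by field.
rewrite lnV ?posrE // => /(_ _) h.
by have {}h := h ltac:(lra); lra.
Qed.

(** The constant [768 * 100 ^+ 2] gives exponent [96 L] after division by 8. Then [k^2 k^-96 <= 1],
    and [96 = 8 * 12] with [eps^8 <= eps / 100], because [eps^7 <= 2^-7]. *)
Lemma dimension_bounds k z eps t (e := eps / 100) :
  (0 < k)%N -> 1 <= z -> 0 < eps -> eps < 1 / 2 ->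
  768 * 100 ^+ 2 * ((ln k%:R + z * ln (1 / eps)) / eps ^+ 2) <= t%:R ->
  [/\ (0 < t)%N, z <= t%:R * e &
    k%:R ^+ 2 * expR (- (t%:R * e ^+ 2 / 8)) <= e `^ (12 * z)].
Proof.
move=> k0 z1 eps0 eps2 Ht; have kR : 1 <= k%:R :> R by rewrite ler1n.
set L := ln k%:R + z * ln (1 / eps) in Ht.
have lnk : 0 <= ln k%:R :> R by exact: ln_ge0.
have lne : 1 / 2 <= ln (1 / eps).
  apply: le_trans ln2_ge_half _; rewrite ler_ln ?posrE ?divr_gt0 //.
  by rewrite ler_pdivlMr //; lra.
have lnE : ln (1 / eps) = - ln eps by rewrite div1r lnV.
have zl : z * (1 / 2) <= z * ln (1 / eps) by rewrite ler_wpM2l //; lra.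
have tL : 96 * L <= t%:R * e ^+ 2 / 8.
  have : 768 * 100 ^+ 2 * L <= t%:R * eps ^+ 2.
    by rewrite -ler_pdivrMr ?exprn_gt0 // -[leLHS]mulrA.
  have H0 : 0 < 100 ^+ 2 :> R by rewrite exprn_gt0.
  rewrite /e expr_div_n => h; set H := 100 ^+ 2 in H0 h *.
  have -> : t%:R * (eps ^+ 2 / H) / 8 = t%:R * eps ^+ 2 / (8 * H).
    by field; rewrite gt_eqF.
  by rewrite ler_pdivlMr ?mulr_gt0 //; lra.
have Lz : z * (1 / 2) <= L by rewrite /L; lra.
have e0 : 0 < e by rewrite divr_gt0.
have e1 : e <= 1 by rewrite /e; lra.
have tR : 0 <= t%:R :> R by [].
have te : t%:R * e ^+ 2 <= t%:R * e.
  by rewrite ler_wpM2l // expr2 ler_piMl // ltW.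
split.
- rewrite lt0n; apply/eqP => t0; move: tL; rewrite t0 !mul0r; lra.
- by lra.
apply: (@le_trans _ _ (k%:R ^+ 2 * expR (- (96 * L)))).
  by rewrite ler_wpM2l ?sqr_ge0 // ler_expR lerN2.
have -> : - (96 * L) = ln k%:R * (- 2) + ln k%:R * (-94) + (8%:R * ln eps) * (12 * z).
  by rewrite /L lnE; ring.
have kpos : 0 < k%:R :> R by lra.
rewrite expRD expRD mulrA mulrA.
have -> : k%:R ^+ 2 * expR (ln k%:R * -2) = 1 :> R.
  rewrite mulrN expRN expRM_natr lnK ?posrE //.
  by rewrite mulfV // expf_neq0 // gt_eqF.
rewrite mul1r -[leRHS]mul1r; apply: ler_pM; rewrite ?expR_ge0 //.
  by rewrite -[leRHS]expR0 ler_expR; lra.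
rewrite expRM; apply: powR_le; rewrite ?expR_ge0 //; first by lra.
rewrite expRM_natl lnK ?posrE // /e.
have h7 : eps ^+ 7 <= (1 / 2) ^+ 7 by rewrite lerXn2r ?nnegrE //; lra.
rewrite exprS ler_wpM2l ?(ltW eps0) //; apply: le_trans h7 _.
by rewrite expr_div_n expr1n div1r lef_pV2 ?posrE ?exprn_gt0 // -natrX ler_nat.
Qed.

(** With [u = e ^ z <= e] each of the four terms is at most [u <= 1 / 200]. The exponent 12 comes
    from [(th * th1)^-1 = k / (u^6 e^5)]: [u^12 <= u * u^6 * e^5]. *)
Lemma failure_probability_bound k z e (del : R) (th1 := e `^ (3 * z))
    (th := th1 * e ^+ 5 / k%:R) :
  (0 < k)%N -> 1 <= z -> 0 < e -> e <= 1 / 200 -> 0 <= del ->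
  k%:R ^+ 2 * del <= e `^ (12 * z) ->
  del * (k%:R ^+ 2 + (th * th1)^-1 + k%:R / th + (1 + e) `^ z / th1) <= 1 / 10.
Proof.
move=> k0 z1 e0 e200 del0 Hdel; have kR : 1 <= k%:R :> R by rewrite ler1n.
pose u := e `^ z; have u0 : 0 < u by rewrite powR_gt0.
have ue : u <= e.
  by rewrite -[leRHS]powRr1 ?(ltW e0) //; apply: ger_powR; rewrite ?e0 //; lra.
have th1E : th1 = u ^+ 3 by rewrite /th1 mulrC powRrM powR_mulrn // ltW.
have powE : e `^ (12 * z) = u ^+ 12 by rewrite mulrC powRrM powR_mulrn // ltW.
rewrite powE in Hdel.
have u1 : u <= 1 by lra.
have kpos : 0 < k%:R :> R by lra.
have delk : del * k%:R <= u ^+ 12.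
  apply: le_trans Hdel; rewrite mulrC expr2 -mulrA ler_peMl //.
  by rewrite mulr_ge0 // ltW.
have del1 : del <= u ^+ 12.
  by apply: le_trans delk; rewrite ler_peMr.
have u5 : u ^+ 5 <= e ^+ 5 by rewrite lerXn2r ?nnegrE ?(ltW u0) ?(ltW e0).
have u12 m : (m < 12)%N -> u ^+ 12 <= u ^+ m.+1.
  by move=> m12; rewrite ler_wiXn2l // ltW.
have [un0 en0 kn0] : [/\ u != 0, e != 0 & k%:R != 0 :> R] by rewrite !gt_eqF.
have b1 : del * k%:R ^+ 2 <= u.
  by rewrite mulrC; apply: le_trans Hdel _; rewrite -[leRHS]expr1 u12.
have b2 : del * (th * th1)^-1 <= u.
  have -> : del * (th * th1)^-1 = del * k%:R / (u ^+ 6 * e ^+ 5).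
    by rewrite /th th1E; field; rewrite un0 en0 kn0.
  rewrite ler_pdivrMr ?mulr_gt0 ?exprn_gt0 //; apply: le_trans delk _.
  rewrite mulrA -exprS; apply: (@le_trans _ _ (u ^+ 7 * u ^+ 5)).
    by rewrite -exprD.
  by rewrite ler_wpM2l // exprn_ge0 // ltW.
have b3 : del * (k%:R / th) <= u.
  have -> : del * (k%:R / th) = k%:R ^+ 2 * del / (u ^+ 3 * e ^+ 5).
    by rewrite /th th1E; field; rewrite un0 en0 kn0.
  rewrite ler_pdivrMr ?mulr_gt0 ?exprn_gt0 //; apply: le_trans Hdel _.
  rewrite mulrA -exprS; apply: (@le_trans _ _ (u ^+ 4 * u ^+ 5)).
    by rewrite -exprD u12.
  by rewrite ler_wpM2l // exprn_ge0 // ltW.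
have b4 : del * ((1 + e) `^ z / th1) <= u.
  have h : (1 + e) `^ z * u <= 1.
    rewrite /u -powRM; [|lra|lra].
    apply: (@le_trans _ _ (1 `^ z)); last by rewrite powR1.
    by apply: powR_le; [lra|rewrite mulr_ge0 //; lra|nra].
  have -> : del * ((1 + e) `^ z / th1) = del * ((1 + e) `^ z * u) / u ^+ 4.
    by rewrite th1E; field.
  rewrite ler_pdivrMr ?exprn_gt0 // -exprS; apply: (@le_trans _ _ del).
    by rewrite ler_piMr.
  by apply: le_trans del1 _; rewrite u12.
by rewrite !mulrDr; lra.
Qed.

(** [N] is about [16 / e^4], so the factor [e^5 / k] in [th] reduces [k * N.+1 + 1] to a small
    multiple of [e]; the spare power of [e] absorbs the 16. *)
Lemma step_bound k z e (th1 := e `^ (3 * z)) (th := th1 * e ^+ 5 / k%:R)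
    (N := (Num.truncn (16 / e ^+ 4)).+1) :
  (0 < k)%N -> 0 < e -> e <= 1 / 200 ->
  16 < N%:R * e ^+ 4 /\ (k * N.+1 + 1)%:R * th <= th1.
Proof.
move=> k0 e0 e200; have kR : 1 <= k%:R :> R by rewrite ler1n.
have e40 : 0 < e ^+ 4 by rewrite exprn_gt0.
have x0 : 0 <= 16 / e ^+ 4 by rewrite divr_ge0 // ltW.
have /andP[Nlo Nhi] := truncn_itv x0; split.
  by rewrite -ltr_pdivrMr.
have th10 : 0 <= th1 by exact: powR_ge0.
have kpos : 0 < k%:R :> R by lra.
rewrite /th mulrA ler_pdivrMr // mulrCA ler_wpM2l //.
have NE : N.+1%:R = (Num.truncn (16 / e ^+ 4))%:R + 2 :> R by rewrite /N -!natr1; lra.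
rewrite natrD natrM NE.
have Ne : (Num.truncn (16 / e ^+ 4))%:R * e ^+ 4 <= 16 by rewrite -ler_pdivlMr.
have e5 : e ^+ 5 = e * e ^+ 4 by rewrite exprS.
have e51 : e ^+ 5 <= e by rewrite -[leRHS]expr1; apply: ler_wiXn2l => //; lra.
have e50 : 0 <= e ^+ 5 by rewrite exprn_ge0 // ltW.
set M := (Num.truncn _)%:R in Ne *.
have Me : M * e ^+ 5 <= 16 * e by rewrite e5 mulrCA mulrC ler_wpM2r // ltW.
have : k%:R * (M * e ^+ 5) <= k%:R * (16 * e) by rewrite ler_wpM2l // ltW.
have : k%:R * e ^+ 5 <= k%:R * e by rewrite ler_wpM2l // ltW.
have : k%:R * e <= k%:R * (1 / 200) by rewrite ler_wpM2l // ltW.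
by lra.
Qed.

End Dimension.

(** * The theorem *)

Section Reduction.
Context {R : realType} {d : measure_display} {T : measurableType d}.
Variables (P : probability T R) (t n : nat) (G : 'I_t -> 'I_n -> {RV P >-> R}).
Variable X : {fset 'cV[R]_n}.

(** Colliding points are counted once in the image set, which could spoil the lower bound. The mean
    of this count is 0, so adding it to [defect] costs nothing. *)
Definition collisions (w : T) : R := \sum_(i : 'I_(#|` X|)) \sum_(j : 'I_(#|` X|))
  ((i != j) && (sqn (random_map G w (fset_point i - fset_point j)) == 0))%:R.

Lemma mean_le_collisions : iid_gaussian_entries G -> (0 < t)%N ->
  mean_le P collisions 0.
Proof.
move=> iidG t0; have -> : 0 = \sum_(i : 'I_(#|` X|)) \sum_(j : 'I_(#|` X|)) 0 :> R.
  by rewrite big1 // => i _; rewrite big1.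
apply: mean_le_sum => i; apply: mean_le_sum => j.
have [ij|ij] := eqVneq i j; rewrite /=.
  by split => //; rewrite integral0.
have vN0 : fset_point i - fset_point j != 0.
  by rewrite subr_eq0; apply: contra_neq ij; exact: fset_point_inj.
have E : [set w | sqn (random_map G w (fset_point i - fset_point j)) == 0] =
    [set w | sqn (random_map G w (fset_point i - fset_point j)) = 0].
  by apply/seteqP; split => w /= /eqP.
apply: mean_le_bool; rewrite E; first exact: measurable_eq0_sqn.
by rewrite prob_random_map_eq0.
Qed.

Lemma collisions_lt1 w : collisions w < 1 -> injective (image_point G w : 'I_(#|` X|) -> _).
Proof.
move=> lt1 i j ij; apply/eqP/negPn/negP => iNj; move: lt1; rewrite ltNge => /negP; apply.
rewrite /collisions (bigD1 i) //= (bigD1 j) //= iNj random_mapB.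
rewrite -!/(image_point _ _ _) ij subrr sqn0 eqxx /=.
rewrite -addrA lerDl addr_ge0 ?sumr_ge0 // => l _.
by rewrite sumr_ge0.
Qed.

Section Preserved.
Variables (k N : nat) (z eps e th th1 : R) (Cstar : {fset 'cV[R]_n}).
Variables (c : 'I_k -> 'cV[R]_n) (sg : {ffun 'I_(#|` X|) -> 'I_k}) (w : T).
Let x := @fset_point R n X.
Let O := total_cost x c sg z.

Hypotheses (t0 : (0 < t)%N) (k0 : (0 < k)%N) (z1 : 1 <= z).
Hypotheses (e0 : 0 < e) (e200 : e <= 1 / 200) (epsE : eps = 100 * e).
Hypothesis optC : optimal_clustering k z X Cstar.
Hypothesis OE : O = cost z X Cstar `^ z.
Hypotheses (O0 : 0 < O) (th0 : 0 < th) (th10 : 0 < th1).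
Hypothesis th1_le : th1 <= e `^ (3 * z).
Hypotheses (HN : 16 < N%:R * e ^+ 4) (th_th1 : (k * N.+1 + 1)%:R * th <= th1).
Hypothesis defect1 : defect G x c sg z e th th1 w < 1.
Hypothesis inj_image : injective (image_point G w : 'I_(#|` X|) -> _).

Lemma cost_preserved : exists C',
  [/\ optimal_clustering k z (image_set G X w) C',
    1 / (1 + eps) * cost z X Cstar <= cost z (image_set G X w) C' &
    cost z (image_set G X w) C' <= (1 + eps) * cost z X Cstar].
Proof.
have [h1 [h2 [h3 [h4 h5]]]] := conj z1 (conj e0 (conj e200 (conj epsE O0))).
have z0 : 0 < z by lra.
have [C0 C0k] := exists_fset_card R k t0.
have w0 i : 0 <= image_weight G (X := X) w i by rewrite ler0n.
have selX := selects_fset_point X; have selY := selects_image_set G X w.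
have weight1 i : image_weight G (X := X) w i = 1.
  by rewrite /image_weight first_occurrence_inj.
have e128 : e <= 1 / 128 by lra.
have [bad0 badp badc exc] := defect_lt1 th0 th10 O0 defect1.
have [C' optC'] := optimal_clustering_exists z0 w0 k0 C0k selY.
exists C'; split; first exact: optC'.
- have [c' [tau E]] := cost_assignment z0 w0 selY optC'.1 k0.
  have th1_ge0 := ltW th10.
  have [|q] := robust_lift z1 e0 e128 HN th0 th1_ge0 O0 _ th1_le
     (Ordinal k0) bad0 badp badc exc c' tau.
    by rewrite card_ord.
  have -> : \sum_i l2norm (random_map G w (x i) - c' (tau i)) `^ z =
      cost z (image_set G X w) C' `^ z.
    by rewrite -E; apply: eq_bigr => i _; rewrite weight1 mul1r.
  have := optimal_clustering_le z0 (fun=> ler01) optC.1 selX q tau optC.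
  rewrite /assign_cost -OE; under eq_bigr do rewrite mul1r.
  move=> Oq qle; have {Oq qle} := le_trans Oq qle; rewrite -/O.
  set V := cost z (image_set G X w) C' => OV.
  have V0 : 0 <= V := cost_ge0 _ _ _.
  have cX0 : 0 <= cost z X Cstar := cost_ge0 _ _ _.
  have ez : e `^ z <= e.
    by rewrite -[leRHS]powRr1 ?(ltW e0) //; apply: ger_powR; rewrite ?e0 //; lra.
  (* As both [e ^ z <= e] and [(1 - e) ^ z <= 1 - e], the additive loss becomes a factor that
     survives the [z]-th root: [(1 - e) ^ z <= 1 - e ^ z]. *)
  have e1z : (1 - e) `^ z <= 1 - e.
    rewrite -[leRHS]powRr1; last by lra.
    by apply: ger_powR => //; apply/andP; split; lra.
  have e1_ge0 : 0 <= 1 - e by lra.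
  have lf0 : 0 <= (1 + e) * lift_factor e.
    by rewrite /lift_factor !mulr_ge0 //; lra.
  have : (1 - e) * cost z X Cstar <= (1 + e) * lift_factor e * V.
    apply: (powR_le_inv z0).
    - exact: mulr_ge0.
    - exact: mulr_ge0.
    rewrite (powRM z lf0 V0) (powRM z e1_ge0 cX0).
    rewrite -OE; apply: (@le_trans _ _ ((1 - e `^ z) * O)); last by lra.
    by rewrite ler_wpM2r ?(ltW O0) //; lra.
  move=> H; rewrite mulrAC ler_pdivrMr; last by lra.
  rewrite mul1r -(@ler_pM2l _ (1 - e)); last by lra.
  apply: le_trans H _; rewrite (mulrC V) [leRHS]mulrA; apply: ler_wpM2r => //.
  (* The inequality is [(1 + e)^2 (1 + 3 e) <= (1 - e) (1 + 100 e)], with ample room for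
     [e <= 1 / 200]. *)
  by rewrite epsE /lift_factor; nra.
pose fc j := random_map G w (c j).
have := optimal_clustering_le z0 w0 C0k selY fc sg optC'.
rewrite /assign_cost; under eq_bigr do rewrite weight1 mul1r.
move=> /le_trans/(_ (robust_upper z1 e0 e128 O0 th1_le exc)).
have cX0 : 0 <= cost z X Cstar := cost_ge0 _ _ _.
have e2_ge0 : 0 <= 1 + 2 * e by lra.
rewrite -/O OE -(powRM z e2_ge0 cX0).
move=> /(powR_le_inv z0 (cost_ge0 _ _ _) (mulr_ge0 e2_ge0 cX0)) H.
apply: le_trans H _.
by rewrite ler_wpM2r //; lra.
Qed.

End Preserved.
End Reduction.

Theorem theorem4p1 (R : realType) :
  exists C0 : R, 0 < C0 /\
  forall (d k : nat) (z : R) (X Cstar : {fset 'cV[R]_d}) (eps : R) (t : nat),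
  (0 < k)%N -> 1 <= z ->
  optimal_clustering k z X Cstar ->
  0 < eps -> eps < 1 / 2 ->
  C0 * ((ln k%:R + z * ln (1 / eps)) / eps ^+ 2) <= t%:R ->
  forall (disp : measure_display) (T : measurableType disp)
    (P : probability T R) (G : 'I_t -> 'I_d -> {RV P >-> R}),
  iid_gaussian_entries G ->
  let E := [set w : T | exists C' : {fset 'cV[R]_t},
    [/\ optimal_clustering k z [fset random_map G w x | x in X]%fset C',
        1 / (1 + eps) * cost z X Cstar
          <= cost z [fset random_map G w x | x in X]%fset C' &
        cost z [fset random_map G w x | x in X]%fset C'
          <= (1 + eps) * cost z X Cstar]] in
  measurable E /\ ((9 / 10)%:E <= P E)%E.
Proof.
exists (768 * 100 ^+ 2); split.
  by apply: mulr_gt0; [rewrite ltr0n|apply: exprn_gt0; rewrite ltr0n].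
move=> d k z X Cstar eps t k0 z1 optC eps0 eps2 Ht disp T P G iidG E.
have [t0 zte Hdel] := dimension_bounds k0 z1 eps0 eps2 Ht.
set e := eps / 100 in zte Hdel.
have z0 : 0 < z by lra.
have cX0 : 0 <= cost z X Cstar := cost_ge0 _ _ _.
have a0 : 0 <= 1 / (1 + eps) * cost z X Cstar by rewrite mulr_ge0 ?divr_ge0 //; lra.
have b0 : 0 <= (1 + eps) * cost z X Cstar by rewrite mulr_ge0 //; lra.
have mE : measurable E := measurable_optimal_cost_between G X z0 k0 t0 a0 b0.
split; first exact: mE.
have [c [sg cE]] := cost_assignment z0 (fun=> ler01) (selects_fset_point X) optC.1 k0.
have OE : total_cost (@fset_point R d X) c sg z = cost z X Cstar `^ z.
  by rewrite -cE; apply: eq_bigr => i _; rewrite mul1r.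
have O_ge0 : 0 <= total_cost (@fset_point R d X) c sg z by rewrite OE powR_ge0.
(* [defect] divides by the total cost, so cost 0 is treated apart: every point equals its center,
   and the image has cost 0 for every [w]. *)
have [tot0|totN0] := eqVneq (total_cost (@fset_point R d X) c sg z) 0.
  suff -> : E = setT by rewrite probability_setT lee_fin; lra.
  apply/seteqP; split => // w _.
  have cX : cost z X Cstar = 0 by apply: (@powR_eq0_eq0 _ _ z); rewrite -OE.
  have [C0 C0k] := exists_fset_card R k t0.
  have w0 i : 0 <= image_weight G (X := X) w i by rewrite ler0n.
  have selY := selects_image_set G X w.
  have [C' optC'] := optimal_clustering_exists z0 w0 k0 C0k selY.
  exists C'; rewrite cX !mulr0; split; [exact: optC'|exact: cost_ge0|].
  have := optimal_clustering_le z0 w0 C0k selY (fun j => random_map G w (c j)) sg optC'.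
  suff -> : assign_cost z (image_weight G w) (image_point G w)
      (fun j => random_map G w (c j)) sg = 0.
    move=> H; apply: (powR_le_inv z0); rewrite ?cost_ge0 //.
    by rewrite [leRHS]powR0 // gt_eqF.
  rewrite /assign_cost big1 // => i _.
  have := psumr_eq0P (fun i _ => powR_ge0 _ z) tot0.
  move=> /(_ i isT)/powR_eq0_eq0/l2norm_eq0 xc.
  by rewrite /image_point -random_mapB xc /random_map mulmx0 l2norm0 powR0 ?mulr0 ?gt_eqF.
have O0 : 0 < total_cost (@fset_point R d X) c sg z by rewrite lt_neqAle eq_sym totN0.
have e0 : 0 < e by rewrite divr_gt0.
have e200 : e <= 1 / 200 by rewrite /e; lra.
have e1 : e <= 1 by lra.
have epsE : eps = 100 * e by rewrite /e; field.
pose th1 := e `^ (3 * z); pose th := th1 * e ^+ 5 / k%:R.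
have th10 : 0 < th1 by rewrite powR_gt0.
have th0 : 0 < th by rewrite !mulr_gt0 ?invr_gt0 ?exprn_gt0 ?ltr0n.
have [HN th_th1] := step_bound z k0 e0 e200.
have mD := mean_le_defect iidG t0 e0 e1 z1 zte th0 th10 O0.
have mDC := mean_le_add mD (mean_le_collisions X iidG t0).
rewrite card_ord addr0 in mDC.
have fail := markov_mean_le mDC.
set f := (fun w => _ + _) in mDC fail.
have mf : measurable [set w | 1 <= f w].
  by case: mDC => mf _ _; apply: measurable_set_bool; exact: measurable_fun_ler.
have sub : ~` [set w | 1 <= f w] `<=` E.
  move=> w /= /negP; rewrite -ltNge /f => lt1.
  have coll0 : 0 <= collisions G X w.
    by apply: sumr_ge0 => i _; apply: sumr_ge0 => j _; rewrite ler0n.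
  have def0 : 0 <= defect G (@fset_point R d X) c sg z e th th1 w.
    by case: mD.
  apply: (cost_preserved t0 k0 z1 e0 e200 epsE optC OE O0 th0 th10 (lexx _) HN th_th1).
    by lra.
  by apply: collisions_lt1; lra.
apply: (@le_trans _ _ (P (~` [set w | 1 <= f w]))); last first.
  by apply: le_measure; rewrite ?inE //; exact: measurableC.
rewrite probability_setC //.
apply: (@le_trans _ _ (1 - (1 / 10)%:E)%E).
  by rewrite -EFinB lee_fin; lra.
rewrite leeB //; apply: le_trans fail _; rewrite lee_fin.
by apply: failure_probability_bound => //; exact: expR_ge0.
Qed.
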